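(* Let $\Lambda$ be a commutative noetherian complete local domain with fraction field $Q(\Lambda)$, $A$ a separable $Q(\Lambda)$-algebra, $R$ a $\Lambda$-order in $A$, and $S\subset\Lambda\setminus\{0\}$ an Ore set of $R$. Assume that every $P\in\mathcal{P}$ has a quadratic presentation $R^a\to R^a\to P\to0$, and that there is an integer $d(R)$ such that $\mathrm{Ext}^i_R(M,R)=0$ for all $i>d(R)$ and all finitely generated left or right $R$-modules $M$. Let $\mathcal{F}=\mathrm{Fitt}^{\max}_R:\mathcal{C}\to\Omega$. Then for every $M\in\mathcal{C}$, \[ \mathcal{F}^{\langle-2\rangle}(M)=\mathcal{F}(M^* ). \]
   Context: $\mathcal M$ is the category of finitely generated $S$-torsion left $R$-modules; $\mathcal C=\{M\in\mathcal M\mid\mathrm{Ext}^i_R(M,R)=0\text{ for all }i\ge2\}$; $\mathcal P=\{P\in\mathcal M\mid\mathrm{pd}_R(P)\le1\}$. The same notions are used for right modules (and the assumption on quadratic presentations holds for left modules iff it holds for right modules, by dualizing). For a left module $M\in\mathcal C$, $M^*=\mathrm{Ext}^1_R(M,R)$ is a right module belonging to the right-module version of $\mathcal C$. $Z(-)$ is the center and $\mathrm{Nrd}:M_a(A)\to Z(A)$ the reduced norm. $\mathcal I(R)$ is the $Z(R)$-submodule of $Z(A)$ generated by all $\mathrm{Nrd}(H)$, $H\in M_a(R)$, $a\ge1$; it is a subring. $\overline S=\mathrm{Nrd}(S)\subset\mathcal I(R)$, and $\Omega$ is the commutative monoid of finitely generated $\mathcal I(R)$-submodules of $\overline S^{-1}\mathcal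 I(R)$. For a presentation $R^b\xrightarrow{h}R^a\to M\to0$ of a finitely generated left (resp. right) module, with $h$ viewed as a matrix, $\mathrm{Fitt}_R(h)$ is the ideal of $\mathcal I(R)$ generated by $\mathrm{Nrd}(H)$ for all $a\times a$ submatrices $H$ of $h$ (obtained by selecting $a$ of the $b$ standard basis vectors of $R^b$), and $\mathrm{Fitt}^{\max}_R(M)$ is the unique maximal one among these ideals over all finite presentations of $M$. Thus $\mathcal F=\mathrm{Fitt}^{\max}_R$ is defined on both left and right modules, with values in the same monoid $\Omega$; $\mathcal F(P)\in\Omega^\times$ for $P\in\mathcal P$. For $M\in\mathcal C$, $\mathcal F^{\langle-2\rangle}(M)$ is defined by taking an exact sequence $0\to M\to P_2\to P_1\to N\to0$ with $N\in\mathcal C$, $P_1,P_2\in\mathcal P$ (and image of $P_2\to P_1$ in $\mathcal C$) and putting $\mathcal F^{\langle-2\rangle}(M)=\mathcal F(P_1)^{-1}\mathcal F(P_2)\mathcal F(N)$; such a sequence exists and the value is independent of its choice. *)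

(* Defs.v *)
From HB Require Import structures.
From mathcomp Require Import all_boot all_order all_algebra fraction all_field.
From mathcomp Require Import boolp classical_sets.

Set Implicit Arguments.
Unset Strict Implicit.
Unset Printing Implicit Defensive.

Import GRing.Theory.

Local Open Scope classical_set_scope.
Local Open Scope ring_scope.

Definition surjective (U V : Type) (f : U -> V) : Prop :=
  forall y, exists x, f x = y.

Definition exact_at (U V : Type) (W : zmodType) (f : U -> V) (g : V -> W) :
  Prop := forall x, g x = 0 <-> exists y, x = f y.

(* Finite sums of products c * g.  When C is a subring this is the C-submodule
   generated by G; when C and G are submodules it is their product. *)
Definition spanset (B : nzRingType) (C G : set B) : set B :=
  [set x | exists (n : nat) (c g : 'I_n -> B),
     [/\ forall k, C (c k), forall k, G (g k) & x = \sum_(k < n) c k * g k]].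

Definition ring_center (B : nzRingType) : set B :=
  [set z | forall x, GRing.comm z x].

Section CommutativeAlgebra.
Context (L : idomainType).

Definition is_ideal (I : set L) : Prop :=
  [/\ I 0, forall x y, I x -> I y -> I (x + y) & forall a x, I x -> I (a * x)].

Definition noetherian_ring : Prop :=
  forall I, is_ideal I -> exists s : seq L, I = spanset setT [set` s].

Definition maxideal : set L := [set x | x \isn't a GRing.unit].

Definition local_ring : Prop := is_ideal maxideal.

Definition maxideal_pow (n : nat) : set L :=
  spanset setT [set x | exists y : 'I_n -> L,
                   (forall k, maxideal (y k)) /\ x = \prod_(k < n) y k].

(* L -> lim L / m^n is injective and surjective. *)
Definition complete_local_ring : Prop :=
  (forall x, (forall n, maxideal_pow n x) -> x = 0) /\
  (forall u : nat -> L, (forall n, maxideal_pow n (u n.+1 - u n)) ->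
     exists l, forall n, maxideal_pow n (u n - l)).

End CommutativeAlgebra.

(* Existence of a separability idempotent \sum x (x) y in A (x)_K A.  As A is
   finite dimensional, an identity in A (x)_K A may be tested after applying
   f (x) id for all linear forms f on A. *)
Definition separable_algebra (K : fieldType) (A : falgType K) : Prop :=
  exists e : seq (A * A),
    \sum_(p <- e) p.1 * p.2 = 1 /\
    forall (a : A) (f : {scalar A}),
      \sum_(p <- e) f (a * p.1) *: p.2 = \sum_(p <- e) f p.1 *: (p.2 * a).

Section Splitting.
Context (K : fieldType) (A : falgType K).

(* A K-algebra morphism A -> \prod_i M_(n i + 1)(E) which becomes an
   isomorphism after extending the scalars of A to E. *)
Definition is_splitting (E : fieldType) (tau : {rmorphism K -> E}) (m : nat)
    (n : 'I_m -> nat) (phi : forall i, {rmorphism A -> 'M[E]_((n i).+1)}) :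
  Prop :=
  (forall i c x, phi i (c *: x) = tau c *: phi i x) /\
  (forall y : forall i, 'M[E]_((n i).+1),
     exists! c : 'rV[E]_(\dim {:A}),
       forall i, y i = \sum_j c 0 j *: phi i (vbasis {:A})`_j).

(* Under a splitting, Nrd is the tuple of determinants in
   \prod_i E = Z(\prod_i M_(n i + 1)(E)), and it descends to Z(A).
   This determines nrd, and does not depend on the splitting. *)
Definition is_reduced_norm (nrd : forall a, 'M[A]_a -> A) : Prop :=
  exists (E : fieldType) (tau : {rmorphism K -> E}) (m : nat)
         (n : 'I_m -> nat) (phi : forall i, {rmorphism A -> 'M[E]_((n i).+1)}),
    is_splitting tau phi /\
    forall a (X : 'M[A]_a),
      ring_center (nrd a X) /\
      forall i, phi i (nrd a X) =
                (\det (\mxblock_(k < a, l < a) phi i (X k l)))%:M.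

End Splitting.

Section Orders.
Context (L : idomainType) (R : algType L).

Definition is_order (A : falgType {fraction L}) (iota : {rmorphism R -> A}) :
  Prop :=
  [/\ injective iota,
      forall l : L, iota l%:A = (tofrac l)%:A,
      exists n (g : 'I_n -> R),
        forall r, exists c : 'I_n -> L, r = \sum_k c k *: g k &
      forall x : A, exists l r, l != 0 /\ x = (tofrac l)^-1 *: iota r].

Definition is_ore_set (S : set L) : Prop :=
  [/\ S 1, forall s t, S s -> S t -> S (s * t),
      forall (r : R) s, S s ->
        exists r' s', S s' /\ s'%:A * r = r' * s%:A &
      forall (r : R) s, S s ->
        exists r' s', S s' /\ r * s'%:A = s%:A * r'].

End Orders.

Section Modules.
Context (R : nzRingType).

(* Left modules are lmodType R and right modules are lmodType R^c.
   Maps R^b -> R^a are x |-> x *m h on row vectors. *)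

Definition finitely_generated (M : lmodType R) : Prop :=
  exists (a : nat) (p : {linear 'rV[R]_a -> M}), surjective p.

Definition presents (a b : nat) (h : 'M[R]_(b, a)) (M : lmodType R) : Prop :=
  exists p : {linear 'rV[R]_a -> M},
    surjective p /\ exact_at (fun x : 'rV_b => x *m h) p.

Definition projective (P : lmodType R) : Prop :=
  forall (V W : lmodType R) (g : {linear V -> W}) (f : {linear P -> W}),
    surjective g -> exists f' : {linear P -> V}, forall x, g (f' x) = f x.

Definition pd_le1 (P : lmodType R) : Prop :=
  exists (Q1 Q0 : lmodType R) (i : {linear Q1 -> Q0}) (p : {linear Q0 -> P}),
    [/\ projective Q1, projective Q0, injective i, surjective p &
        exact_at i p].

Definition free_resolution (M : lmodType R) (n : nat -> nat)
    (d : forall k, 'M[R]_(n k.+1, n k)) (p : {linear 'rV[R]_(n 0%N) -> M}) :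
  Prop :=
  [/\ surjective p, exact_at (fun x : 'rV_(n 1%N) => x *m d 0%N) p &
      forall k, exact_at (fun x : 'rV_(n k.+2) => x *m d k.+1)
                         (fun x : 'rV_(n k.+1) => x *m d k)].

(* Hom_R(-, R) of a resolution.  Identifying Hom_R(R^n, R) with the right
   module of column vectors, it is given by left multiplication by d k, that
   is by right multiplication by (d k)^T on rows over R^c. *)
Definition dual_diff (n : nat -> nat) (d : forall k, 'M[R]_(n k.+1, n k))
    (k : nat) (v : 'rV[R^c]_(n k)) : 'rV[R^c]_(n k.+1) :=
  v *m ((d k)^T : 'M[R^c]_(n k, n k.+1)).

Definition dual_cocycle (n : nat -> nat) (d : forall k, 'M[R]_(n k.+1, n k))
    (k : nat) : set 'rV[R^c]_(n k) := [set v | dual_diff d v = 0].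

Definition dual_coboundary (n : nat -> nat)
    (d : forall k, 'M[R]_(n k.+1, n k)) (k : nat) : set 'rV[R^c]_(n k) :=
  match k return set 'rV[R^c]_(n k) with
  | 0 => [set 0]
  | k'.+1 => range (@dual_diff n d k')
  end.

(* N is isomorphic to Ext^i_R(M, R): the map f, linear on the cocycles,
   induces an isomorphism from cocycles modulo coboundaries onto N. *)
Definition is_Ext (i : nat) (M : lmodType R) (N : lmodType R^c) : Prop :=
  exists (n : nat -> nat) (d : forall k, 'M[R]_(n k.+1, n k))
         (p : {linear 'rV[R]_(n 0%N) -> M}) (f : 'rV[R^c]_(n i) -> N),
    [/\ free_resolution d p,
        forall (r : R^c) v w, dual_cocycle d v -> dual_cocycle d w ->
          f (r *: v + w) = r *: f v + f w,
        forall y, exists v, dual_cocycle d v /\ f v = y &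
        forall v, dual_cocycle d v -> (f v = 0 <-> dual_coboundary d v)].

Definition Ext_vanishes (i : nat) (M : lmodType R) : Prop :=
  is_Ext i M 'rV[R^c]_0.

End Modules.

Section Classes.
Context (L : idomainType) (R : algType L) (S : set L).

Definition torsion (M : lmodType R) : Prop :=
  forall x : M, exists s, S s /\ (s%:A : R) *: x = 0.

Definition in_M (M : lmodType R) : Prop := finitely_generated M /\ torsion M.

Definition in_C (M : lmodType R) : Prop :=
  in_M M /\ forall i, (2 <= i)%N -> Ext_vanishes i M.

Definition in_P (P : lmodType R) : Prop := in_M P /\ pd_le1 P.

(* An integer d(R) exists for left and for right modules. *)
Definition finite_Ext_bound : Prop :=
  exists d : nat,
    (forall i (M : lmodType R), (d < i)%N -> finitely_generated M ->
       Ext_vanishes i M) /\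
    (forall i (M : lmodType R^c), (d < i)%N -> finitely_generated M ->
       Ext_vanishes i M).

Definition quadratic_presentations : Prop :=
  forall P : lmodType R, in_P P -> exists a (h : 'M[R]_a), presents h P.

End Classes.

(* Fitting ideals over B = R or B = R^c, for a function N on square matrices
   over B with values in A, and a subring I of A. *)
Section Fitting.
Context (A B : nzRingType) (N : forall a, 'M[B]_a -> A) (I : set A).

Definition fitt (a b : nat) (h : 'M[B]_(b, a)) : set A :=
  spanset I [set x | exists f : 'I_a -> 'I_b,
                       injective f /\ x = N (rowsub f h)].

Definition fitting_ideal (M : lmodType B) (J : set A) : Prop :=
  exists a b (h : 'M[B]_(b, a)), presents h M /\ J = fitt h.

(* Over an order the family is directed and a maximal member exists, so it is
   unique and the default value of xget plays no role. *)
Definition fittmax (M : lmodType B) : set A :=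
  xget [set 0] [set J | fitting_ideal M J /\
    forall J', fitting_ideal M J' -> J `<=` J' -> J' = J].

End Fitting.

Section FittingInvariants.
Context (L : idomainType) (A : falgType {fraction L}) (R : algType L).
Context (iota : {rmorphism R -> A}) (nrd : forall a, 'M[A]_a -> A).
Context (S : set L).

Definition nrdl (a : nat) (H : 'M[R]_a) : A := nrd (map_mx iota H).

(* A matrix over R^c acting on rows is the transpose of the matrix over R
   acting on columns. *)
Definition nrdr (a : nat) (H : 'M[R^c]_a) : A := nrdl (H^T : 'M[R]_a).

Definition IR : set A :=
  spanset (iota @` @ring_center R)
    [set x | exists a (H : 'M[R]_a), (0 < a)%N /\ x = nrdl H].

Definition Fittmaxl (M : lmodType R) : set A := fittmax nrdl IR M.

Definition Fittmaxr (M : lmodType R^c) : set A := fittmax nrdr IR M.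

(* The elements Nrd(s) are units of Z(A), so the localization of I(R) at
   Nrd(S) is a subring of Z(A). *)
Definition localized_IR : set A :=
  [set x | exists y s, [/\ IR y, S s &
     x = y / nrdl ((s%:A)%:M : 'M[R]_1)]].

Definition Omega : set (set A) :=
  [set X | exists g : seq A,
     [set` g] `<=` localized_IR /\ X = spanset IR [set` g]].

Definition Omega_mul (X Y : set A) : set A := spanset X Y.

Definition Omega_inv (X : set A) : set A :=
  xget [set 0] [set Y | Omega Y /\ Omega_mul Y X = IR].

Definition Fittmax_shift_sequence (M P2 P1 N : lmodType R) : Prop :=
  exists (f : {linear M -> P2}) (g : {linear P2 -> P1}) (q : {linear P1 -> N})
         (Im : lmodType R) (p : {linear P2 -> Im}) (j : {linear Im -> P1}),
    [/\ injective f, exact_at f g, exact_at g q & surjective q] /\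
    [/\ surjective p, injective j, forall x, g x = j (p x) & in_C S Im] /\
    [/\ in_C S N, in_P S P1 & in_P S P2].

(* The invariant F^<-2> of F = Fittmaxl: the value given by any such sequence. *)
Definition Fittmax_shift (M : lmodType R) : set A :=
  xget [set 0] [set X | exists P2 P1 N,
    Fittmax_shift_sequence M P2 P1 N /\
    X = Omega_mul (Omega_mul (Omega_inv (Fittmaxl P1)) (Fittmaxl P2))
                  (Fittmaxl N)].

End FittingInvariants.

(* Main.v *)
(* Lift P_2 -> P_1 to square presentation matrices, h_2 G_0 = G_1 h_1.  The
   rows of [G_0; h_1] present N and, because Ext^2(N, R) = Ext^3(N, R) = 0, the
   columns of [h_2, -G_1] present M^*.  As [h_2, -G_1] [G_0; h_1] = 0, complementary
   maximal minors v of [G_0; h_1] and u of [h_2, -G_1] satisfy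
   Nrd(h_2) Nrd(v) = e Nrd(h_1) Nrd(u) with e the norm of a permutation matrix,
   so the two Fitting ideals differ by the factor Nrd(h_1) / Nrd(h_2).  Any
   presentation of N can be completed to a larger one of this form whose partner
   still presents M^*, and conversely; hence the families of Fitting ideals of N
   and of M^* dominate each other up to this factor, and so do their maxima.

   For the existence of a sequence, let s in S kill M.  Generators of the
   1-cocycles with values in R embed M in (R/s)^a, and generators of the
   relations between their classes give (R/s)^a -> (R/s)^b with kernel M;
   exactness is the vanishing of Ext over the opposite ring in large degrees. *)
From HB Require Import structures.
From mathcomp Require Import all_boot all_order all_algebra fraction all_field.
From mathcomp Require Import boolp classical_sets perm.
Require Import Defs.

Set Implicit Arguments.
Unset Strict Implicit.
Unset Printing Implicit Defensive.

Import GRing.Theory.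

Local Open Scope classical_set_scope.
Local Open Scope ring_scope.

(** * Cokernels of matrices *)

(** Two obstacles shape the proof. Minors over a noncommutative ring admit no Laplace expansion, so
    relations between them have to come from multiplicativity of the reduced norm on products and on
    block triangular matrices; this is why presentations are only enlarged by triangular blocks with
    an identity on the diagonal, which leave Nrd(h_1) and Nrd(h_2) unchanged. Moreover Ext is given
    by an unspecified free resolution, while its vanishing is needed for particular ones, namely
    iterated mapping cones over a resolution of M. Vanishing is therefore handled through
    [dual_exact], a property of a single matrix, which is transported by homotopies between pairs of
    consecutive terms.

    Transposing h_2 G_0 = G_1 h_1 exchanges N with M^* and left with right modules, so the converse
    comparison is the same argument over the opposite ring. Since every admissible sequence is shown
    to give the Fitting invariant of M^*, independence of the choice is a by-product. *)

Section Cokernel.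
Local Open Scope quotient_scope.
Context (B : nzRingType) (a b : nat) (h : 'M[B]_(b, a)).

Let in_image (x : 'rV[B]_a) := `[< exists y, x = y *m h >].

Lemma in_imageB x y : in_image x -> in_image y -> in_image (x - y).
Proof.
move=> /asboolP[u ->] /asboolP[v ->]; apply/asboolP.
by exists (u - v); rewrite mulmxBl.
Qed.

Lemma in_image0 : in_image 0.
Proof. by apply/asboolP; exists 0; rewrite mul0mx. Qed.

Lemma in_imageN x : in_image x -> in_image (- x).
Proof. by rewrite -sub0r; apply: in_imageB in_image0. Qed.

Lemma in_imageD x y : in_image x -> in_image y -> in_image (x + y).
Proof. by move=> Ix Iy; rewrite -(opprK y); apply/in_imageB/in_imageN. Qed.

Lemma in_imageZ c x : in_image x -> in_image (c *: x).
Proof.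
move=> /asboolP[u ->]; apply/asboolP.
by exists (c *: u); rewrite scalemxAl.
Qed.

Definition coker_eq (x y : 'rV[B]_a) := in_image (x - y).

Lemma coker_eq_equiv : equiv_class_of coker_eq.
Proof.
split=> [x | x y | y x z]; rewrite /coker_eq ?subrr ?in_image0 //.
  by apply/idP/idP => /in_imageN; rewrite opprB.
by move=> xy yz; rewrite -(subrK y x) -addrA in_imageD.
Qed.

Canonical coker_equiv := EquivRelPack coker_eq_equiv.
Canonical coker_encModRel := defaultEncModRel coker_eq.

Definition coker := {eq_quot coker_eq}.
HB.instance Definition _ := Choice.on coker.
HB.instance Definition _ := EqQuotient.on coker.

Let pi (x : 'rV[B]_a) : coker := \pi_coker x.

Lemma coker_piP x y : reflect (pi x = pi y) (in_image (x - y)).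
Proof. exact: (eqmodP coker_equiv). Qed.

Lemma coker_pi_repr (q : coker) : pi (repr q) = q.
Proof. exact: reprK. Qed.

Lemma coker_repr_pi x : in_image (repr (pi x) - x).
Proof. by apply/coker_piP; rewrite coker_pi_repr. Qed.

Definition coker_add (q r : coker) : coker := pi (repr q + repr r).
Definition coker_opp (q : coker) : coker := pi (- repr q).
Definition coker_scale (c : B) (q : coker) : coker := pi (c *: repr q).

Lemma coker_addE x y : coker_add (pi x) (pi y) = pi (x + y).
Proof. by apply/coker_piP; rewrite opprD addrACA in_imageD ?coker_repr_pi. Qed.

Lemma coker_oppE x : coker_opp (pi x) = pi (- x).
Proof. by apply/coker_piP; rewrite -opprD in_imageN ?coker_repr_pi. Qed.

Lemma coker_scaleE c x : coker_scale c (pi x) = pi (c *: x).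
Proof. by apply/coker_piP; rewrite -scalerBr in_imageZ ?coker_repr_pi. Qed.

Lemma coker_pi_surj q : exists x, q = pi x.
Proof. by exists (repr q); rewrite coker_pi_repr. Qed.

Fact coker_addA : associative coker_add.
Proof.
move=> q r t; have [x ->] := coker_pi_surj q.
have [y ->] := coker_pi_surj r; have [z ->] := coker_pi_surj t.
by rewrite !coker_addE addrA.
Qed.

Fact coker_addC : commutative coker_add.
Proof.
move=> q r; have [x ->] := coker_pi_surj q; have [y ->] := coker_pi_surj r.
by rewrite !coker_addE addrC.
Qed.

Fact coker_add0 : left_id (pi 0) coker_add.
Proof.
by move=> q; have [x ->] := coker_pi_surj q;
   rewrite !coker_addE add0r.
Qed.

Fact coker_addN : left_inverse (pi 0) coker_opp coker_add.
Proof.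
by move=> q; have [x ->] := coker_pi_surj q;
   rewrite coker_oppE !coker_addE addNr.
Qed.

HB.instance Definition _ :=
  GRing.isZmodule.Build coker coker_addA coker_addC coker_add0 coker_addN.

Lemma coker_piD x y : pi x + pi y = pi (x + y).
Proof. exact: coker_addE. Qed.

Fact coker_scaleA c d q :
  coker_scale c (coker_scale d q) = coker_scale (c * d) q.
Proof. by have [x ->] := coker_pi_surj q; rewrite !coker_scaleE scalerA. Qed.

Fact coker_scale1 : left_id 1 coker_scale.
Proof.
by move=> q; have [x ->] := coker_pi_surj q;
   rewrite coker_scaleE scale1r.
Qed.

Fact coker_scaleDr : right_distributive coker_scale +%R.
Proof.
move=> c q r; have [x ->] := coker_pi_surj q; have [y ->] := coker_pi_surj r.
by rewrite !(coker_piD, coker_scaleE) scalerDr.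
Qed.

Fact coker_scaleDl q :
  {morph coker_scale^~ q : c d / c + d >-> c + d}.
Proof.
have [x ->] := coker_pi_surj q => c d.
by rewrite !coker_scaleE scalerDl coker_piD.
Qed.

HB.instance Definition _ := GRing.Zmodule_isLmodule.Build B coker
  coker_scaleA coker_scale1 coker_scaleDr coker_scaleDl.

Fact coker_pi_linear : linear pi.
Proof. by move=> c x y; rewrite -coker_piD -coker_scaleE. Qed.

HB.instance Definition _ :=
  GRing.isLinear.Build B 'rV[B]_a coker _ pi coker_pi_linear.

(** Makes a matrix into a module, so that hypotheses quantified over modules, above all the bound on
    Ext, apply to it. *)
Lemma presents_coker : presents h coker.
Proof.
exists pi; split=> [q | x]; first by exists (repr q); apply: coker_pi_repr.
rewrite -[X in _ = X]/(pi 0); split=> [/coker_piP | [y ->]].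
  by rewrite subr0 => /asboolP.
by apply/coker_piP/asboolP; exists y; rewrite subr0.
Qed.

End Cokernel.

(** * Linear maps and matrices *)

Section LinearMaps.
Context (B : nzRingType).

Lemma linear_bundle (U V : lmodType B) (f : U -> V) :
  linear f -> exists f' : {linear U -> V}, forall x, f' x = f x.
Proof.
move=> f_lin.
pose F : {linear U -> V} := HB.pack f (GRing.isLinear.Build B U V _ f f_lin).
by exists F.
Qed.

Lemma linear_quotient (U M V : lmodType B) (p : {linear U -> M})
    (g : {linear U -> V}) :
  surjective p -> (forall x, p x = 0 -> g x = 0) ->
  exists g' : {linear M -> V}, forall x, g' (p x) = g x.
Proof.
move=> /choice[r pr] ker_pg.
have gr x : g (r (p x)) = g x.
  by apply/subr0_eq; rewrite -linearB ker_pg // linearB /= pr subrr.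
have gr_lin : linear (g \o r).
  move=> c x y /=; rewrite -linearP -[RHS]gr; congr (g (r _)).
  by rewrite linearP /= !pr.
have [g' g'E] := linear_bundle gr_lin.
by exists g' => x; rewrite g'E /= gr.
Qed.

Lemma factor_rows a b c (X : 'M[B]_(c, a)) (h : 'M[B]_(b, a)) :
  (forall i, exists y, row i X = y *m h) -> exists Y, X = Y *m h.
Proof.
move=> /fin_all_exists[y Xy]; exists (\matrix_i y i).
by apply/row_matrixP => i; rewrite row_mul rowK Xy.
Qed.

Lemma lift_free a b (V : lmodType B) (g : {linear 'rV[B]_a -> V})
    (q : {linear 'rV[B]_b -> V}) :
  surjective q -> exists X, forall x, q (x *m X) = g x.
Proof.
move=> q_surj.
have [X qX] := fin_all_exists (fun i => q_surj (g (delta_mx 0 i))).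
exists (\matrix_i X i) => x; rewrite mulmx_sum_row [x in RHS]row_sum_delta.
rewrite !linear_sum; apply: eq_bigr => i _.
by rewrite !linearZ /= rowK qX.
Qed.

Lemma lift_exact a b c (V : lmodType B) (h : 'M[B]_(b, a))
    (q : {linear 'rV[B]_a -> V}) (X : 'M[B]_(c, a)) :
  exact_at (fun x : 'rV_b => x *m h) q -> (forall x, q (x *m X) = 0) ->
  exists Y, X = Y *m h.
Proof.
move=> hq qX; apply: factor_rows => i; apply/hq.
by rewrite rowE qX.
Qed.

Lemma exact_mul0 a b (V : lmodType B) (h : 'M[B]_(b, a))
    (q : {linear 'rV[B]_a -> V}) x :
  exact_at (fun x : 'rV_b => x *m h) q -> q (x *m h) = 0.
Proof. by move=> hq; apply/hq; exists x. Qed.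

Lemma exact_mulmx_factor a b c e (h1 : 'M[B]_(c, b)) (h0 : 'M[B]_(b, a))
    (X : 'M[B]_(e, b)) :
  exact_at (fun x : 'rV_c => x *m h1) (fun x : 'rV_b => x *m h0) ->
  X *m h0 = 0 -> exists Y, X = Y *m h1.
Proof.
move=> h10 X0; apply: factor_rows => i; apply/h10.
by rewrite -row_mul X0 row0.
Qed.

Lemma exact_mulmx0 a b c (h1 : 'M[B]_(c, b)) (h0 : 'M[B]_(b, a)) :
  exact_at (fun x : 'rV_c => x *m h1) (fun x : 'rV_b => x *m h0) ->
  h1 *m h0 = 0.
Proof.
move=> h10; apply/row_matrixP => i; rewrite row0 row_mul.
by apply/h10; exists (delta_mx 0 i); rewrite rowE.
Qed.

Lemma projective_free a : projective 'rV[B]_a.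
Proof.
move=> V W g f g_surj.
have [v gv] := fin_all_exists (fun i => g_surj (f (delta_mx 0 i))).
have f'_lin : linear (fun x : 'rV[B]_a => \sum_i x 0 i *: v i).
  move=> c x y; rewrite scaler_sumr -big_split; apply: eq_bigr => i _ /=.
  by rewrite !mxE scalerDl scalerA.
have [f' f'E] := linear_bundle f'_lin.
exists f' => x; rewrite f'E [x in RHS]row_sum_delta !linear_sum.
by apply: eq_bigr => i _; rewrite !linearZ /= gv.
Qed.

End LinearMaps.

(** * Ext and free resolutions *)

Section DualExactness.
Context (B : nzRingType).

(** For [h] the differential [d i] of a free resolution of M this says Ext^(i+1)(M, B) = 0. Testing
    a column on the kernel of [h], not with [d i.+1], makes it a property of one matrix. *)
Definition dual_exact a b (h : 'M[B]_(b, a)) : Prop :=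
  forall v : 'cV_b, (forall x : 'rV_b, x *m h = 0 -> x *m v = 0) ->
  exists w, v = h *m w.

(* Chain maps in both directions between the start of two complexes, and a
   homotopy from one composite to the identity, seen after applying [h']. *)
Definition homotopic_part a b (h : 'M[B]_(b, a)) a' b' (h' : 'M[B]_(b', a')) :
    Prop :=
  exists X0 X1 X0' X1' T,
    [/\ h *m X0 = X1 *m h', h' *m X0' = X1' *m h &
        h' *m (1%:M - X0' *m X0 - T *m h') = 0].

Lemma homotopic_part_dual_exact a b (h : 'M[B]_(b, a)) a' b'
    (h' : 'M[B]_(b', a')) :
  homotopic_part h h' -> dual_exact h -> dual_exact h'.
Proof.
move=> [X0 [X1 [X0' [X1' [T [hX hX' hT]]]]]] h_ex v kv.
have [|w X1v] := h_ex (X1 *m v).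
  by move=> x xh; rewrite mulmxA kv // -mulmxA -hX mulmxA xh mul0mx.
(* The homotopy relation places the rows of this matrix in the kernel of [h'], on which [v]
   vanishes. *)
have : (1%:M - X1' *m X1 - h' *m T) *m v = 0.
  apply/row_matrixP => i; rewrite row0 row_mul kv // -row_mul.
  suff -> : (1%:M - X1' *m X1 - h' *m T) *m h' = 0 by rewrite row0.
  rewrite -[RHS]hT !(mulmxBl, mulmxBr) mul1mx mulmx1 !mulmxA hX'.
  by rewrite -!(mulmxA X1') hX mulmxA.
rewrite !mulmxBl mul1mx -!mulmxA X1v (mulmxA X1') -hX' -!mulmxA.
move/eqP; rewrite -addrA -opprD subr_eq0 -mulmxDr => /eqP ->.
by eexists.
Qed.

(** Comparison of resolutions, one degree further: [1 - X1' X1 - h0' T] is killed by [h0'], so it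
    factors through [h1']. As only consecutive matrices enter, the step also applies along exact
    sequences not given as resolutions. *)
Lemma homotopic_part_step a b c (h0 : 'M[B]_(b, a)) (h1 : 'M[B]_(c, b))
    a' b' c' (h0' : 'M[B]_(b', a')) (h1' : 'M[B]_(c', b')) :
  exact_at (fun x : 'rV_c => x *m h1) (fun x : 'rV_b => x *m h0) ->
  exact_at (fun x : 'rV_c' => x *m h1') (fun x : 'rV_b' => x *m h0') ->
  homotopic_part h0 h0' -> homotopic_part h1 h1'.
Proof.
move=> ex ex' [X0 [X1 [X0' [X1' [T [hX hX' hT]]]]]].
have [X2 hX2] : exists X2, h1 *m X1 = X2 *m h1'.
  apply: (exact_mulmx_factor ex').
  by rewrite -mulmxA -hX mulmxA (exact_mulmx0 ex) mul0mx.
have [X2' hX2'] : exists X2', h1' *m X1' = X2' *m h1.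
  apply: (exact_mulmx_factor ex).
  by rewrite -mulmxA -hX' mulmxA (exact_mulmx0 ex') mul0mx.
have [|T' T'E] := @exact_mulmx_factor _ _ _ _ _ _ _
                     (1%:M - X1' *m X1 - h0' *m T) ex'.
  rewrite -[RHS]hT !(mulmxBl, mulmxBr) mul1mx mulmx1 !mulmxA hX'.
  by rewrite -!(mulmxA X1') hX mulmxA.
exists X1, X2, X1', X2', T'; split=> //.
rewrite -T'E opprB addrCA subrr addr0.
by rewrite mulmxA (exact_mulmx0 ex') mul0mx.
Qed.

Lemma presents_homotopic_part a b (h : 'M[B]_(b, a)) a' b' (h' : 'M[B]_(b', a'))
    (M : lmodType B) :
  presents h M -> presents h' M -> homotopic_part h h'.
Proof.
move=> [p [p_surj hp]] [p' [p'_surj hp']].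
have [X0 X0E] := lift_free p p'_surj; have [X0' X0'E] := lift_free p' p_surj.
have [|X1 hX] := @lift_exact _ _ _ _ _ _ _ (h *m X0) hp'.
  by move=> x; rewrite mulmxA X0E exact_mul0.
have [|X1' hX'] := @lift_exact _ _ _ _ _ _ _ (h' *m X0') hp.
  by move=> x; rewrite mulmxA X0'E exact_mul0.
have [|T TE] := @lift_exact _ _ _ _ _ _ _ (1%:M - X0' *m X0) hp'.
  by move=> x; rewrite mulmxBr mulmx1 linearB /= mulmxA X0E X0'E subrr.
by exists X0, X1, X0', X1', T; rewrite TE subrr mulmx0.
Qed.

Lemma resolution_presents (M : lmodType B) n (d : forall k, 'M[B]_(n k.+1, n k))
    (p : {linear 'rV[B]_(n 0%N) -> M}) :
  free_resolution d p -> presents (d 0) M.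
Proof. by case=> p_surj dp _; exists p. Qed.

Lemma resolution_homotopic_part (M : lmodType B)
    n (d : forall k, 'M[B]_(n k.+1, n k)) p
    n' (d' : forall k, 'M[B]_(n' k.+1, n' k)) p' :
  @free_resolution B M n d p -> @free_resolution B M n' d' p' ->
  forall k, homotopic_part (d k) (d' k).
Proof.
move=> res res'; elim=> [|k].
  exact: presents_homotopic_part (resolution_presents res)
                                 (resolution_presents res').
by case: res res' => _ _ ex [_ _ ex']; apply: homotopic_part_step.
Qed.

Lemma dual_diffE n (d : forall k, 'M[B]_(n k.+1, n k)) k v :
  dual_diff d v = (d k *m v^T)^T.
Proof. by rewrite trmx_mul_rev trmxK. Qed.

Lemma Ext_vanishes_dual_exact i (M : lmodType B) :
  Ext_vanishes i.+1 M -> exists n d p,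
    @free_resolution B M n d p /\ dual_exact (d i).
Proof.
move=> [n [d [p [f [res _ _ f0]]]]]; exists n, d, p; split=> // v kv.
have dv : d i.+1 *m v = 0.
  apply/row_matrixP => j; rewrite row0 row_mul kv //.
  by case: res => _ _ ex; rewrite -row_mul (exact_mulmx0 (ex i)) row0.
have [|+ _] := f0 (v^T : 'rV[B^c]_(n i.+1)).
  by rewrite /dual_cocycle /= dual_diffE trmxK dv trmx0.
case=> [|w _]; first by apply/matrixP => j [].
rewrite dual_diffE => /(congr1 trmx); rewrite !trmxK => <-.
by exists w^T.
Qed.

Lemma dual_exact_Ext_vanishes i (M : lmodType B) n d p :
  @free_resolution B M n d p -> dual_exact (d i) -> Ext_vanishes i.+1 M.
Proof.
move=> res d_ex; exists n, d, p, (fun=> 0).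
split=> // [r v w _ _ | y | v cv]; first by rewrite scaler0 addr0.
  exists 0; split; last by apply/matrixP => j [].
  by rewrite /dual_cocycle /dual_diff /= mul0mx.
split=> // _; have [|w vw] := d_ex v^T.
  case: res => _ _ ex x /ex[y ->]; rewrite -mulmxA.
  move/(congr1 trmx): cv; rewrite dual_diffE trmxK trmx0 => ->.
  by rewrite mulmx0.
exists (w^T : 'rV[B^c]_(n i)) => //; rewrite dual_diffE trmxK -vw.
by rewrite trmxK.
Qed.

(** [is_Ext] speaks of one unspecified resolution; by comparison the vanishing can be used on any
    given one. *)
Lemma Ext_vanishes_resolution i (M : lmodType B) n d p :
  Ext_vanishes i.+1 M -> @free_resolution B M n d p -> dual_exact (d i).
Proof.
move=> /Ext_vanishes_dual_exact[n' [d' [p' [res' d'_ex]]]] res.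
exact: homotopic_part_dual_exact (resolution_homotopic_part res' res i) d'_ex.
Qed.

End DualExactness.

(** * Mapping cones of resolutions *)

Section Cone.
Context (B : nzRingType).

Lemma mulmx_central a b c (X : 'M[B]_(a, b)) :
  (forall y, GRing.comm c y) -> X *m c%:M = c *: X.
Proof.
move=> c_central; apply/matrixP => i j.
by rewrite -diag_const_mx mul_mx_diag !mxE c_central.
Qed.

Definition cone_size (a m : nat) (n : nat -> nat) (k : nat) : nat :=
  match k with 0 => a | 1 => m + n 0%N | k'.+2 => n k'.+1 end.

Definition cone_diff (a m : nat) (n : nat -> nat)
    (d : forall k, 'M[B]_(n k.+1, n k)) (h : 'M[B]_(m, a))
    (f0 : 'M[B]_(n 0%N, a)) (f1 : 'M[B]_(n 1%N, m)) (k : nat) :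
    'M[B]_(cone_size a m n k.+1, cone_size a m n k) :=
  match k with
  | 0 => col_mx h f0
  | 1 => row_mx f1 (- d 0)
  | k'.+2 => d k'.+1
  end.

(* The mapping cone of a chain map from a resolution of M to the two-term
   resolution h of P, when the induced map M -> P is injective with
   cokernel K. *)
Lemma cone_resolution (M K : lmodType B) (a m : nat) (n : nat -> nat)
    (d : forall k, 'M[B]_(n k.+1, n k)) (p : {linear 'rV[B]_(n 0%N) -> M})
    (h : 'M[B]_(m, a)) (f0 : 'M[B]_(n 0%N, a)) (f1 : 'M[B]_(n 1%N, m))
    (q : {linear 'rV[B]_a -> K}) :
  free_resolution d p -> d 0 *m f0 = f1 *m h ->
  (forall x : 'rV_m, x *m h = 0 -> x = 0) ->
  (forall x y, x *m f0 = y *m h -> p x = 0) ->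
  surjective q -> (forall t, q t = 0 <-> exists x y, t = x *m f0 + y *m h) ->
  free_resolution (cone_diff d h f0 f1) q.
Proof.
move=> [p_surj dp ex] df h_inj f_inj q_surj qE; split=> //.
  move=> t; split=> [/qE[x [y ->]] | [xy /= ->]].
    by exists (row_mx y x); rewrite /= mul_row_col addrC.
  apply/qE; exists (rsubmx xy), (lsubmx xy).
  by rewrite -[xy in LHS]hsubmxK mul_row_col addrC.
have df1 : d 1 *m f1 = 0.
  apply/row_matrixP => i; rewrite row0; apply: h_inj.
  by rewrite row_mul -!mulmxA -df mulmxA -row_mul (exact_mulmx0 (ex 0)) row0
             mul0mx.
case=> [|[|k]] x /=.
- split=> [|[z ->]]; last first.
    by rewrite -mulmxA mul_row_col mulNmx df subrr mulmx0.
  rewrite -[x]hsubmxK mul_row_col => /eqP; rewrite addr_eq0 => /eqP x0.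
  have [|w xw] := (dp (rsubmx x)).1.
    by apply: (f_inj _ (- lsubmx x)); rewrite mulNmx x0 opprK.
  exists (- w); rewrite mul_mx_row mulmxN !mulNmx opprK -xw; congr row_mx.
  apply/subr0_eq/h_inj; rewrite opprK mulmxDl x0 -mulmxA -df mulmxA.
  by rewrite -xw addNr.
- split=> [|[z ->]]; last first.
    by rewrite -mulmxA mul_mx_row df1 mulmxN (exact_mulmx0 (ex 0)) oppr0
               row_mx0 mulmx0.
  rewrite mul_mx_row -row_mx0 => /eq_row_mx[_ /eqP].
  by rewrite mulmxN oppr_eq0 => /eqP/ex.
- exact: ex.
Qed.

(** Only Ext^2 of the cokernel is new. It is squeezed between Ext^1(P, B) -> Ext^1(M, B) and
    Ext^2(P, B) = 0, and the first map is onto when the columns of [f1] generate all 1-cocycles. *)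
Lemma cone_dual_exact (a m : nat) (n : nat -> nat)
    (d : forall k, 'M[B]_(n k.+1, n k)) (h : 'M[B]_(m, a))
    (f0 : 'M[B]_(n 0%N, a)) (f1 : 'M[B]_(n 1%N, m)) :
  d 1 *m d 0 = 0 -> d 1 *m f1 = 0 ->
  (forall v : 'cV_(n 1%N), d 1 *m v = 0 -> exists y, v = f1 *m y) ->
  (forall k, dual_exact (d k.+1)) ->
  forall k, dual_exact (cone_diff d h f0 f1 k.+1).
Proof.
move=> dd df f1_ex d_ex [|k]; last exact: d_ex.
move=> v kv; have [|y ->] := f1_ex v.
  apply/row_matrixP => i; rewrite row0 row_mul kv //=.
  by rewrite -row_mul mul_mx_row df mulmxN dd oppr0 row_mx0 row0.
by exists (col_mx y 0); rewrite mul_row_col mulmx0 addr0.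
Qed.

End Cone.

(** * Syzygies under a bound on Ext *)

Section ExtBound.
Context (B : nzRingType) (D : nat).

Definition Ext_bounded : Prop :=
  forall i (M : lmodType B), (D < i)%N -> finitely_generated M ->
  Ext_vanishes i M.

Lemma presents_finitely_generated a b (h : 'M[B]_(b, a)) M :
  presents h M -> finitely_generated M.
Proof. by case=> p [p_surj _]; exists a, p. Qed.

Lemma coker_resolution a b (h : 'M[B]_(b, a)) :
  Ext_bounded -> exists n (d : forall k, 'M[B]_(n k.+1, n k)) p,
    [/\ @free_resolution B (coker h) n d p, presents (d 0) (coker h) &
        forall k, (D <= k)%N -> dual_exact (d k)].
Proof.
move=> bound; have ph := presents_coker h.
have fg := presents_finitely_generated ph.
have [n [d [p [res _]]]] := Ext_vanishes_dual_exact (bound D.+1 _ (leqnn _) fg).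
exists n, d, p; split=> // [|k Dk]; first exact: resolution_presents res.
exact: (Ext_vanishes_resolution (bound k.+1 _ _ fg) res).
Qed.

(** The finite free resolution of [coker h] starts from another presentation [d 0]. An [x] in the
    kernel of [h] equals [x X1' X1 + x e], and [x X1'] lies in the kernel of [d 0], hence in the
    image of [d 1]. *)
Lemma kernel_generated a b (h : 'M[B]_(b, a)) : Ext_bounded ->
  exists c (g : 'M_(c, b)), exact_at (fun x : 'rV_c => x *m g)
                                     (fun x : 'rV_b => x *m h).
Proof.
move=> /(coker_resolution h)[n [d [p [[_ _ ex] pd _]]]].
have [X0 [X1 [X0' [X1' [T [hX hX' hT]]]]]] :=
  presents_homotopic_part pd (presents_coker h).
pose e := 1%:M - X1' *m X1 - h *m T.
have eh : e *m h = 0.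
  rewrite -[RHS]hT !(mulmxBl, mulmxBr) mul1mx mulmx1 !mulmxA hX'.
  by rewrite -!(mulmxA X1') hX mulmxA.
exists _, (col_mx (d 1 *m X1) e) => x; split=> [xh | [y ->]].
  have [|y xX] := (ex 0 (x *m X1')).1.
    by rewrite -mulmxA -hX' mulmxA xh mul0mx.
  exists (row_mx y x); rewrite mul_row_col mulmxA -xX /e !mulmxBr mulmx1.
  by rewrite !mulmxA xh mul0mx subr0 addrC subrK.
rewrite -mulmxA mul_col_mx eh -mulmxA -hX mulmxA (exact_mulmx0 (ex 0)).
by rewrite mul0mx col_mx0 mulmx0.
Qed.

(* Going left along an exact sequence that is infinite to the right is going
   up in a resolution of a cokernel, which may be taken arbitrarily far. *)
Lemma coresolution_dual_exact (r : nat -> nat)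
    (h : forall k, 'M[B]_(r k, r k.+1)) :
  Ext_bounded ->
  (forall k, exact_at (fun x : 'rV_(r k) => x *m h k)
                      (fun x : 'rV_(r k.+1) => x *m h k.+1)) ->
  dual_exact (h 0).
Proof.
move=> bound h_ex.
have climb n (d : forall k, 'M[B]_(n k.+1, n k)) m :
    (forall k, exact_at (fun x : 'rV_(n k.+2) => x *m d k.+1)
                        (fun x : 'rV_(n k.+1) => x *m d k)) ->
    forall j, homotopic_part (d j) (h m) -> homotopic_part (d (j + m)%N) (h 0).
  move=> d_ex; elim: m => [|m IHm] j dh; first by rewrite addn0.
  rewrite addnS -addSn; apply/IHm; exact: homotopic_part_step dh.
(* Over [coker (h D)] the matrix [h D] plays the part of [d 0] and [h 0] that of [d D], which
   governs Ext in degree D + 1, the first beyond the bound. *)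
have [n [d [p [[_ _ d_ex] pd d_dual]]]] := coker_resolution (h D) bound.
apply: homotopic_part_dual_exact (d_dual D (leqnn D)).
exact: climb d_ex 0%N (presents_homotopic_part pd (presents_coker (h D))).
Qed.

End ExtBound.

Section Columns.
Context (B : nzRingType) (D : nat) (bound : Ext_bounded B^c D).

Lemma column_kernel_generated a b (h : 'M[B]_(a, b)) :
  exists c (g : 'M[B]_(b, c)), forall v : 'cV_b,
    h *m v = 0 <-> exists w : 'cV_c, v = g *m w.
Proof.
have [c [g gh]] := kernel_generated (h^T : 'M[B^c]_(b, a)) bound.
exists c, (g^T : 'M[B]_(b, c)) => v; split=> [hv | [w ->]].
  have [|y vy] := (gh (v^T : 'rV[B^c]_b)).1.
    by rewrite -trmx_mul_rev hv trmx0.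
  exists (y^T : 'cV[B]_c).
  by apply: trmx_inj; rewrite vy trmx_mul_rev !trmxK.
apply: trmx_inj; rewrite trmx_mul_rev trmx0; apply/gh.
exists (w^T : 'rV[B^c]_c).
by rewrite (trmx_mul_rev (g^T : 'M[B]_(b, c)) w) trmxK.
Qed.

Lemma column_coresolution_dual_exact (r : nat -> nat)
    (h : forall k, 'M[B]_(r k.+1, r k)) :
  (forall k (v : 'cV_(r k.+1)),
     h k.+1 *m v = 0 <-> exists w : 'cV_(r k), v = h k *m w) ->
  forall k (z : 'rV_(r k)),
    (forall v : 'cV_(r k), h k *m v = 0 -> z *m v = 0) ->
    exists w, z = w *m h k.
Proof.
move=> h_ex k z kz.
pose h' j : 'M[B^c]_(r (j + k)%N, r (j + k).+1) := (h (j + k)%N)^T.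
have h'E j x : x *m h' j = (h (j + k)%N *m x^T)^T.
  by rewrite (trmx_mul_rev (h (j + k)%N)) trmxK.
have [j x||w zw] := @coresolution_dual_exact B^c D (fun j => r (j + k)%N) h'
                      bound _ (z^T : 'cV[B^c]_(r k)).
- rewrite !h'E; split=> [/(congr1 trmx) | [y ->]].
    rewrite trmxK trmx0 => /h_ex[y xy]; exists y^T.
    by rewrite h'E trmxK -xy trmxK.
  rewrite h'E trmxK (_ : h _ *m _ = 0) ?trmx0 //.
  by apply/h_ex; eexists.
- move=> x; rewrite h'E => /(congr1 trmx); rewrite trmxK trmx0 => /kz zx.
  by have := trmx_mul_rev z (x^T : 'cV[B]_(r k)); rewrite zx trmx0 trmxK.
exists (w^T : 'rV[B]_(r k.+1)); apply: trmx_inj; rewrite zw.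
by rewrite (trmx_mul_rev (w^T : 'rV[B]_(r k.+1))) trmxK.
Qed.

End Columns.

(** * Existence of the four-term sequence *)

Section DualEmbedding.
Context (B : nzRingType) (sigma : B).
Context (sigma_central : forall y, GRing.comm sigma y).
Context (sigma_regular : forall y, sigma * y = 0 -> y = 0).

Lemma scale_regular a b (X : 'M[B]_(a, b)) : sigma *: X = 0 -> X = 0.
Proof.
move=> /matrixP X0; apply/matrixP => i j; rewrite [RHS]mxE.
by apply: sigma_regular; have := X0 i j; rewrite !mxE.
Qed.

Lemma mulmx_scalar_regular a b (X : 'M[B]_(a, b)) : X *m sigma%:M = 0 -> X = 0.
Proof. by rewrite mulmx_central //; apply: scale_regular. Qed.

Lemma scalar_mx_mulC a b (X : 'M[B]_(a, b)) : sigma%:M *m X = X *m sigma%:M.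
Proof. by rewrite mulmx_central // mul_scalar_mx. Qed.

Lemma presents_annihilated (M : lmodType B) a b (h : 'M[B]_(b, a)) :
  presents h M -> (forall x : M, sigma *: x = 0) ->
  exists k, sigma%:M = k *m h.
Proof.
move=> [p [_ hp]] M0; apply: (lift_exact hp) => x.
by rewrite mulmx_central // linearZ /= M0.
Qed.

Lemma column_exact_mul0 a b c (h : 'M[B]_(a, b)) (g : 'M[B]_(b, c)) :
  (forall v : 'cV_b, h *m v = 0 <-> exists w : 'cV_c, v = g *m w) ->
  h *m g = 0.
Proof.
move=> hg; apply/matrixP => i j; rewrite [RHS]mxE.
have /matrixP/(_ i 0) : h *m col j g = 0.
  by apply/hg; exists (delta_mx j 0); rewrite colE.
by rewrite !mxE => h0; rewrite -[RHS]h0; apply: eq_bigr => k _; rewrite mxE.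
Qed.

(* With s = sigma, a choice f1 of generators of the 1-cocycles embeds M in
   (R/s)^a, and G : (R/s)^a -> (R/s)^b has kernel M; the exactness comes
   from the vanishing of Ext in large degrees over the opposite ring. *)
Lemma dual_embedding D (M : lmodType B) n (d : forall k, 'M[B]_(n k.+1, n k))
    p :
  Ext_bounded B^c D -> @free_resolution B M n d p ->
  (forall x : M, sigma *: x = 0) ->
  (forall i, (2 <= i)%N -> Ext_vanishes i M) ->
  exists a b (f0 : 'M[B]_(n 0%N, a)) (f1 : 'M[B]_(n 1%N, a)) (G : 'M[B]_(a, b))
         (w : 'M[B]_(n 0%N, b)),
    [/\ d 0 *m f0 = f1 *m sigma%:M, f0 *m G = w *m sigma%:M,
        forall (x : 'rV_(n 0%N)) y, x *m f0 = y *m sigma%:M -> p x = 0 &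
        forall (y : 'rV_a) t, y *m G = t *m sigma%:M ->
          exists x y', y = x *m f0 + y' *m sigma%:M] /\
    [/\ d 1 *m f1 = 0,
        forall v : 'cV_(n 1%N), d 1 *m v = 0 -> exists y, v = f1 *m y,
        row_mx f1 (- d 0) *m col_mx G w = 0 &
        forall v : 'cV_(a + n 0%N), row_mx f1 (- d 0) *m v = 0 ->
          exists y, v = col_mx G w *m y].
Proof.
move=> bound res M0 M_Ext; have [_ dp ex] := res.
have [tau tauE] := presents_annihilated (resolution_presents res) M0.
(* This is Hom(M, B) = 0: the regular scalar [sigma] kills M, so it factors as [tau] times [d 0]. *)
have d_inj c (X : 'M_(_, c)) : d 0 *m X = 0 -> X = 0.
  move=> dX; apply: scale_regular.
  by rewrite -mul_scalar_mx tauE -mulmxA dX mulmx0.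
have [a [f1 f1_ex]] := column_kernel_generated bound (d 1).
have [b [g g_ex]] := column_kernel_generated bound (row_mx f1 (- d 0)).
have df1 := column_exact_mul0 f1_ex; have fg := column_exact_mul0 g_ex.
have [|Y dtau] := @exact_mulmx_factor _ _ _ _ _ _ _
                    (d 0 *m tau - sigma%:M) (ex 0).
  by rewrite mulmxBl -mulmxA -tauE scalar_mx_mulC subrr.
pose G := usubmx g; pose w := dsubmx g.
(* [tau] and [Y] contract multiplication by [sigma] on the resolution; on cocycles the term with
   [d 1] drops out. *)
have [f0 df0] : exists f0, d 0 *m f0 = f1 *m sigma%:M.
  exists (tau *m f1); rewrite mulmxA -[d 0 *m tau](subrK sigma%:M) dtau.
  by rewrite mulmxDl -mulmxA df1 mulmx0 add0r scalar_mx_mulC.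
have f1G : f1 *m G = d 0 *m w.
  move: fg; rewrite -[g]vsubmxK mul_row_col mulNmx => /eqP.
  by rewrite subr_eq0 => /eqP.
have f0G : f0 *m G = w *m sigma%:M.
  apply/subr0_eq/d_inj; rewrite mulmxBr !mulmxA df0 -f1G.
  by rewrite -!mulmxA scalar_mx_mulC subrr.
(* This sequence of columns is exact: at its start by the choice of generators, further on because
   Ext^i(M, B) = 0 for i >= 2. The bound on Ext then gives exactness on rows, [hA] and [hB]. *)
pose r k := match k with 0 => b | 1 => a + n 0 | k'.+2 => n k'.+1 end.
pose h k : 'M[B]_(r k.+1, r k) :=
  match k with 0 => g | 1 => row_mx f1 (- d 0) | k'.+2 => d k'.+1 end.
have [hA hB] : (forall z : 'rV_(a + n 0%N),
    (forall v : 'cV_(a + n 0%N), row_mx f1 (- d 0) *m v = 0 -> z *m v = 0) ->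
    exists u, z = u *m row_mx f1 (- d 0)) /\
  (forall z : 'rV_b, (forall v : 'cV_b, g *m v = 0 -> z *m v = 0) ->
    exists u, z = u *m g).
  have h_ex k (v : 'cV_(r k.+1)) :
      h k.+1 *m v = 0 <-> exists w : 'cV_(r k), v = h k *m w.
    case: k v => [|[|k]] v /=; first exact: g_ex.
      split=> [/f1_ex[y ->] | [y ->]].
        by exists (col_mx y 0); rewrite mul_row_col mulmx0 addr0.
      by rewrite mulmxA mul_mx_row df1 mulmxN (exact_mulmx0 (ex 0)) oppr0
                 row_mx0 mul0mx.
    split=> [dv | [y ->]]; last by rewrite mulmxA (exact_mulmx0 (ex _)) mul0mx.
    apply: (Ext_vanishes_resolution (M_Ext k.+2 isT) res) => x /ex[y ->].
    by rewrite -mulmxA dv mulmx0.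
  have := column_coresolution_dual_exact bound h_ex.
  by move=> h_dual; split; [apply: (h_dual 1%N) | apply: (h_dual 0%N)].
(* The equation says that the row [[y, -x]] vanishes on the columns of [g], that is on the kernel of
   [[f1, -d 0]]. *)
have kill (y : 'rV_a) (x : 'rV_(n 0%N)) : y *m G = x *m w ->
    exists u, y = u *m f1 /\ x = u *m d 0.
  move=> yx; have [|u] := hA (row_mx y (- x)).
    move=> v /g_ex[t ->]; rewrite mulmxA -[g]vsubmxK mul_row_col mulNmx.
    by rewrite yx subrr mul0mx.
  rewrite mul_mx_row mulmxN => /eq_row_mx[-> /oppr_inj ->].
  by exists u.
exists a, b, f0, f1, G, w; split; split=> //.
- move=> x y xy; have [|u [_ ->]] := kill y x; last exact: exact_mul0.
  apply/subr0_eq/mulmx_scalar_regular; rewrite mulmxBl -!mulmxA -f0G.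
  by rewrite -scalar_mx_mulC !mulmxA xy subrr.
- move=> y t yt; have [|z tz] := hB t.
    move=> v; rewrite -[g]vsubmxK mul_col_mx -col_mx0 => /eq_col_mx[Gv _].
    apply/mulmx_scalar_regular; rewrite -mulmxA -scalar_mx_mulC mulmxA -yt.
    by rewrite -mulmxA Gv mulmx0.
  rewrite -[z]hsubmxK -[g]vsubmxK mul_row_col in tz.
  exists (rsubmx z), (lsubmx z).
  have [|u []] := kill (y - (rsubmx z *m f0 + lsubmx z *m sigma%:M)) 0.
    rewrite mul0mx mulmxBl yt tz !mulmxDl -!mulmxA f0G scalar_mx_mulC.
    by rewrite [X in X - _]addrC subrr.
  move=> yu /esym/(ex 0)[u' uE].
  by move: yu; rewrite uE -mulmxA df1 mulmx0 => /subr0_eq.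
- by move=> v /f1_ex.
- by rewrite vsubmxK.
- by move=> v /g_ex; rewrite vsubmxK.
Qed.

End DualEmbedding.

Section ShiftSequence.
Context (L : idomainType) (R : algType L) (S : set L).
Context (S1 : S 1) (SM : forall s t, S s -> S t -> S (s * t)).
Context (S_regular : forall s (x : R), S s -> s%:A * x = 0 -> x = 0).

Lemma alg_central (s : L) (y : R) : GRing.comm s%:A y.
Proof. by rewrite /GRing.comm mulr_algl mulr_algr. Qed.

Lemma in_M_annihilator (M : lmodType R) :
  in_M S M -> exists s, S s /\ forall x : M, (s%:A : R) *: x = 0.
Proof.
move=> [[a [p p_surj]] M_tors].
have [s sP] := fin_all_exists (fun i => M_tors (p (delta_mx 0 i))).
exists (\prod_i s i); split; first by apply: big_ind => // i _; case: (sP i).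
have s0 i : ((\prod_j s j)%:A : R) *: p (delta_mx 0 i) = 0.
  rewrite (bigD1 i) //= mulrC -scalerA -mulr_algl -scalerA.
  by case: (sP i) => _ ->; rewrite scaler0.
move=> x; have [y <-] := p_surj x; rewrite [y]row_sum_delta !linear_sum /=.
rewrite scaler_sumr; apply: big1 => i _.
by rewrite linearZ /= scalerA alg_central -scalerA s0 scaler0.
Qed.

Lemma presents_in_M (M : lmodType R) a b (h : 'M[R]_(b, a)) k s :
  S s -> presents h M -> (s%:A)%:M = k *m h -> in_M S M.
Proof.
move=> Ss ph kh; split; first exact: presents_finitely_generated ph.
case: ph => p [p_surj hp] x; exists s; split=> //.
have [y <-] := p_surj x; rewrite -linearZ /=.
rewrite -mulmx_central; last exact: alg_central.
by rewrite kh mulmxA exact_mul0.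
Qed.

Lemma coker_scalar_in_P a s :
  S s -> in_P S (coker ((s%:A)%:M : 'M[R]_a)).
Proof.
move=> Ss; have ph := presents_coker ((s%:A)%:M : 'M[R]_a); split.
  by apply: (presents_in_M (k := 1%:M) Ss ph); rewrite mul1mx.
case: ph => p [p_surj hp].
have [|i iE] := @linear_bundle R 'rV[R]_a 'rV_a (fun x => x *m (s%:A)%:M).
  by move=> c x y; rewrite mulmxDl scalemxAl.
exists 'rV[R]_a, 'rV[R]_a, i, p; split=> //; try exact: projective_free.
  apply: raddf_inj => x /=; rewrite iE.
  apply: mulmx_scalar_regular; first exact: alg_central.
  by move=> y; apply: S_regular.
by move=> x; rewrite hp; split=> -[y ->]; exists y; rewrite iE.
Qed.

(** Here P2 = (R/s)^a and P1 = (R/s)^b. Resolving Im and then N by successive cones reduces their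
    Ext vanishing to that of M and to the choice of [f1] and [G]. *)
Lemma shift_sequence_exists (M : lmodType R) :
  finite_Ext_bound R -> in_C S M ->
  exists P2 P1 N, Fittmax_shift_sequence S M P2 P1 N.
Proof.
move=> [D [_ bound]] [M_in_M M_Ext].
have [s [Ss M0]] := in_M_annihilator M_in_M.
have s_central := alg_central s.
have s_regular (y : R) : s%:A * y = 0 -> y = 0 by exact: S_regular.
have [n [d [p [res _]]]] := Ext_vanishes_dual_exact (M_Ext 2 isT).
have [a [b [f0 [f1 [G [w]]]]]] :=
  dual_embedding s_central s_regular bound res M0 M_Ext.
case=> [[df0 f0G f0_inj G_ker] [df1 f1_ex fG G_ex]].
set sa := (s%:A)%:M : 'M[R]_a in df0 f0_inj G_ker.
pose sb := (s%:A)%:M : 'M[R]_b.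
have saG : sa *m G = G *m sb by exact: scalar_mx_mulC.
have [p2 [p2_surj sa_p2]] := presents_coker sa.
have [p1 [p1_surj sb_p1]] := presents_coker sb.
have [pI [pI_surj f0_pI]] := presents_coker (col_mx f0 sa).
have [pN [pN_surj G_pN]] := presents_coker (col_mx G sb).
have pIE t : pI t = 0 <-> exists x y, t = x *m f0 + y *m sa.
  rewrite f0_pI; split=> [[z ->] | [x [y ->]]].
    by exists (lsubmx z), (rsubmx z); rewrite -mul_row_col hsubmxK.
  by exists (row_mx x y); rewrite mul_row_col.
have pNE t : pN t = 0 <-> exists x y, t = x *m G + y *m sb.
  rewrite G_pN; split=> [[z ->] | [x [y ->]]].
    by exists (lsubmx z), (rsubmx z); rewrite -mul_row_col hsubmxK.
  by exists (row_mx x y); rewrite mul_row_col.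
have [|f0' f0'E] := @linear_bundle R _ _ (fun x => p2 (x *m f0)).
  by move=> c x y; rewrite mulmxDl -scalemxAl linearP.
have [|G' G'E] := @linear_bundle R _ _ (fun x => p1 (x *m G)).
  by move=> c x y; rewrite mulmxDl -scalemxAl linearP.
have [||f fE] := linear_quotient (p := p) (g := f0'); first by case: res.
  case: res => _ dp _ x /dp[y ->]; rewrite f0'E -mulmxA df0 mulmxA.
  exact: exact_mul0.
have [|g gE] := linear_quotient (g := G') p2_surj.
  by move=> x /sa_p2[y ->]; rewrite G'E -mulmxA saG mulmxA exact_mul0.
have [|q qE] := linear_quotient (g := pN) p1_surj.
  move=> x /sb_p1[y ->]; apply/pNE; exists 0, y.
  by rewrite mul0mx add0r.
have [|pr prE] := linear_quotient (g := pI) p2_surj.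
  move=> x /sa_p2[y ->]; apply/pIE; exists 0, y.
  by rewrite mul0mx add0r.
have [|j jE] := linear_quotient (g := G') pI_surj.
  move=> x /pIE[y [z ->]]; rewrite G'E mulmxDl -!mulmxA saG f0G !mulmxA.
  by rewrite -mulmxDl exact_mul0.
have sa_inj (x : 'rV_a) : x *m sa = 0 -> x = 0.
  exact: mulmx_scalar_regular.
have sb_inj (x : 'rV_b) : x *m sb = 0 -> x = 0.
  exact: mulmx_scalar_regular.
have resI := cone_resolution res df0 sa_inj f0_inj pI_surj pIE.
have dd : d 1 *m d 0 = 0 by case: res => _ _ ex; apply: exact_mulmx0 (ex 0).
have exI : forall k, dual_exact (cone_diff d sa f0 f1 k.+1).
  apply: cone_dual_exact => // k.
  exact: Ext_vanishes_resolution (M_Ext k.+2 isT) res.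
have ddI : cone_diff d sa f0 f1 1 *m cone_diff d sa f0 f1 0 = 0.
  by case: resI => _ _ ex; apply: exact_mulmx0 (ex 0).
(* [col_mx G w] is for Im what [f1] is for M: its columns generate the 1-cocycles, by [G_ex]. *)
have resN : free_resolution
    (cone_diff (cone_diff d sa f0 f1) sb G (col_mx G w)) pN.
  apply: (cone_resolution resI) => //=.
    by rewrite mul_col_mx saG f0G mul_col_mx.
  by move=> x y /G_ker xy; apply/pIE.
have exN : forall k,
    dual_exact (cone_diff (cone_diff d sa f0 f1) sb G (col_mx G w) k.+1).
  exact: cone_dual_exact.
exists (coker sa), (coker sb), (coker (col_mx G sb)).
exists f, g, q, (coker (col_mx f0 sa)), pr, j; split; first split.
- apply: raddf_inj => m /=; have [x <-] : exists x, p x = m by case: res.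
  by rewrite fE f0'E => /sa_p2[y /f0_inj].
- move=> y; have [u <-] := p2_surj y; rewrite gE G'E; split.
    move=> /sb_p1[t /G_ker[x [y' ->]]]; exists (p x).
    by rewrite fE f0'E linearD /= [p2 (y' *m sa)]exact_mul0 // addr0.
  move=> [m]; have [x <-] : exists x, p x = m by case: res.
  move=> ufx; have : g (p2 u) = 0.
    by rewrite ufx fE f0'E gE G'E -mulmxA f0G mulmxA exact_mul0.
  by rewrite gE G'E.
- move=> t; have [v <-] := p1_surj t; rewrite qE; split.
    move=> /pNE[x [y ->]]; exists (p2 x).
    by rewrite gE G'E linearD /= [p1 (y *m sb)]exact_mul0 // addr0.
  move=> [y]; have [u <-] := p2_surj y; rewrite gE G'E -qE => ->.
  by rewrite qE; apply/pNE; exists u, 0; rewrite mul0mx addr0.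
- by move=> y; have [t <-] := pN_surj y; exists (p1 t).
split; first split.
- by move=> y; have [t <-] := pI_surj y; exists (p2 t).
- apply: raddf_inj => y /=; have [t <-] := pI_surj y.
  by rewrite jE G'E => /sb_p1[u /G_ker xy]; apply/pIE.
- by move=> y; have [t <-] := p2_surj y; rewrite gE prE jE.
- split.
    apply: (presents_in_M (k := row_mx 0 1%:M) Ss (presents_coker _)).
    by rewrite mul_row_col mul0mx mul1mx add0r.
  by case=> [|[|k]] // _; apply: dual_exact_Ext_vanishes resI _.
split; [split | exact: (coker_scalar_in_P b Ss) |
         exact: (coker_scalar_in_P a Ss)].
  apply: (presents_in_M (k := row_mx 0 1%:M) Ss (presents_coker _)).
  by rewrite mul_row_col mul0mx mul1mx add0r.
by case=> [|[|k]] // _; apply: dual_exact_Ext_vanishes resN _.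
Qed.

End ShiftSequence.

(** * Presentation of the dual *)

Section DualPresentation.
Context (B : nzRingType).

(** The columns of [f1] generate the 1-cocycles modulo coboundaries, and those of [u] generate the
    relations between their classes. Columns form a right module, hence the transpose over [B^c]. *)
Lemma presents_dual (M : lmodType B) (Mstar : lmodType B^c) n
    (d : forall k, 'M[B]_(n k.+1, n k)) (p : {linear 'rV[B]_(n 0%N) -> M})
    (f : 'rV[B^c]_(n 1%N) -> Mstar) a b (f1 : 'M[B]_(n 1%N, a))
    (u : 'M[B]_(a, b)) :
  free_resolution d p ->
  (forall (r : B^c) v w, dual_cocycle d v -> dual_cocycle d w ->
     f (r *: v + w) = r *: f v + f w) ->
  (forall y, exists v, dual_cocycle d v /\ f v = y) ->
  (forall v, dual_cocycle d v -> (f v = 0 <-> dual_coboundary d v)) ->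
  d 1 *m f1 = 0 ->
  (forall v : 'cV_(n 1%N), d 1 *m v = 0 ->
     exists y w, v = f1 *m y + d 0 *m w) ->
  (forall y, (exists w : 'cV_(n 0%N), f1 *m y = d 0 *m w) <->
             (exists z, y = u *m z)) ->
  presents (u^T : 'M[B^c]_(b, a)) Mstar.
Proof.
move=> res f_lin f_surj f_ker df1 f1_ex uE.
pose t (y : 'rV[B^c]_a) : 'rV[B^c]_(n 1%N) := (f1 *m y^T)^T.
have t_cocycle y : dual_cocycle d (t y).
  by rewrite /dual_cocycle /= dual_diffE trmxK mulmxA df1 mul0mx trmx0.
have t_lin (r : B^c) x y : t (r *: x + y) = r *: t x + t y.
  have tE z : t z = z *m (f1^T : 'M[B^c]_(a, n 1%N)).
    by rewrite /t (trmx_mul_rev f1) trmxK.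
  by rewrite !tE mulmxDl scalemxAl.
have [|q qE] := @linear_bundle B^c 'rV[B^c]_a Mstar (f \o t).
  by move=> r x y /=; rewrite t_lin f_lin.
exists q; split=> [m | y].
  have [v [+ <-]] := f_surj m; rewrite /dual_cocycle /= dual_diffE.
  move=> /(congr1 trmx); rewrite trmxK trmx0 => /f1_ex[y [w vE]].
  exists (y^T : 'rV[B^c]_a); rewrite qE /=.
  pose v0 : 'rV[B^c]_(n 1%N) := (d 0 *m w)^T.
  have v0_cob : dual_coboundary d v0.
    by exists (w^T : 'rV[B^c]_(n 0%N)); rewrite // dual_diffE trmxK.
  have v0_coc : dual_cocycle d v0.
    rewrite /dual_cocycle /= dual_diffE trmxK mulmxA.
    by case: res => _ _ ex; rewrite (exact_mulmx0 (ex 0)) mul0mx trmx0.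
  have -> : v = (1 : B^c) *: t y^T + v0.
    by apply: trmx_inj; rewrite vE scale1r linearD /= !trmxK.
  by rewrite f_lin // scale1r [f v0](f_ker _ _).2 // addr0.
rewrite qE /= (f_ker _ (t_cocycle y)); split=> [[w _] | [z ->]].
  rewrite dual_diffE => /trmx_inj/esym dw.
  have [|z yz] := (uE y^T).1; first by exists w^T.
  exists (z^T : 'rV[B^c]_b).
  by have := trmx_mul_rev u z; rewrite -yz trmxK.
have [|w fw] := (uE (u *m z^T)).2; first by eexists.
exists (w^T : 'rV[B^c]_(n 0%N)); rewrite // dual_diffE trmxK /t -fw.
by have := trmx_mul_rev u (z^T : 'cV[B]_b); rewrite trmxK => <-; rewrite trmxK.
Qed.

End DualPresentation.

Section ShiftSequenceMatrices.
Context (L : idomainType) (R : algType L) (S : set L).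
Context (quadratic : quadratic_presentations R S).
Context (square_regular : forall P a (h : 'M[R]_a), in_P S P -> presents h P ->
  forall x : 'rV_a, x *m h = 0 -> x = 0).

(** In the double cone that resolves N, Ext^3(N, R) = 0 says that the columns of [f1] generate M^*,
    and Ext^2(N, R) = 0 that all their relations come from [[h2, -G1]]. *)
Lemma shift_sequence_matrices (M : lmodType R) (Mstar : lmodType R^c) P2 P1 N :
  is_Ext 1 M Mstar -> Fittmax_shift_sequence S M P2 P1 N ->
  exists a2 a1 (h2 : 'M[R]_a2) (h1 : 'M[R]_a1) (G0 G1 : 'M[R]_(a2, a1)),
    [/\ presents h2 P2, presents h1 P1, presents (col_mx G0 h1) N,
        h2 *m G0 = G1 *m h1 &
        presents ((row_mx h2 (- G1))^T : 'M[R^c]_(a2 + a1, a2)) Mstar].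
Proof.
move=> [n [d [p [F [res F_lin F_surj F_ker]]]]].
move=> [f [g [q [Im [pr [j]]]]]].
case=> [[f_inj fg gq q_surj] [[pr_surj j_inj gE _] [[N_M N_Ext] P1_P P2_P]]].
have [a2 [h2 ph2]] := quadratic P2_P; have [a1 [h1 ph1]] := quadratic P1_P.
have h2_inj := square_regular P2_P ph2; have h1_inj := square_regular P1_P ph1.
have [p2 [p2_surj hp2]] := ph2; have [p1 [p1_surj hp1]] := ph1.
have [p_surj dp ex] := res.
have [f0 f0E] := lift_free (f \o p) p2_surj.
have [G0 G0E] := lift_free (g \o p2) p1_surj.
have [|f1 df0] := lift_exact (X := d 0 *m f0) hp2.
  by move=> x; rewrite mulmxA f0E /= (exact_mul0 _ dp) linear0.
have [|G1 hG] := lift_exact (X := h2 *m G0) hp1.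
  by move=> x; rewrite mulmxA G0E /= (exact_mul0 _ hp2) linear0.
have [|w f0G] := lift_exact (X := f0 *m G0) hp1.
  by move=> x; rewrite mulmxA G0E /= f0E; apply/fg; eexists.
have df1 : d 1 *m f1 = 0.
  apply/row_matrixP => i; rewrite row0; apply: h2_inj.
  by rewrite row_mul -!mulmxA -df0 mulmxA -row_mul (exact_mulmx0 (ex 0)) row0
             mul0mx.
have f1G : f1 *m G1 = d 0 *m w.
  apply/subr0_eq/row_matrixP => i; rewrite row0; apply: h1_inj.
  rewrite -row_mul mulmxBl -!mulmxA -hG -f0G !mulmxA df0 subrr.
  by rewrite row0.
have f0_inj (x : 'rV_(n 0%N)) y : x *m f0 = y *m h2 -> p x = 0.
  move=> xy; apply: f_inj; rewrite linear0 -[LHS]/((f \o p) x) -f0E xy.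
  exact: exact_mul0.
have prE t : (pr \o p2) t = 0 <-> exists x y, t = x *m f0 + y *m h2.
  have -> : (pr \o p2) t = 0 <-> g (p2 t) = 0.
    rewrite gE /=; split=> [->|]; first by rewrite linear0.
    by rewrite -[RHS](linear0 j) => /j_inj.
  split=> [/fg[m] | [x [y ->]]].
    have [x <-] := p_surj m; rewrite -[f _]/((f \o p) x) -f0E => /eqP.
    rewrite -subr_eq0 -linearB => /eqP/hp2[y /eqP].
    by rewrite subr_eq addrC => /eqP ->; exists x, y.
  rewrite linearD /= [p2 (y *m h2)]exact_mul0 // addr0 f0E.
  by apply/fg; exists (p x).
have qE t : (q \o p1) t = 0 <-> exists x y, t = x *m G0 + y *m h1.
  split=> [/gq[m] | [x [y ->]]].
    have [x <-] := p2_surj m; rewrite -[g _]/((g \o p2) x) -G0E => /eqP.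
    rewrite -subr_eq0 -linearB => /eqP/hp1[y /eqP].
    by rewrite subr_eq addrC => /eqP ->; exists x, y.
  rewrite linearD /= [p1 (y *m h1)]exact_mul0 // linear0 addr0 G0E.
  by apply/gq; exists (p2 x).
have pr_p2_surj : surjective (pr \o p2).
  move=> y; have [x <-] := pr_surj y; have [t <-] := p2_surj x.
  by exists t.
have q_p1_surj : surjective (q \o p1).
  move=> y; have [x <-] := q_surj y; have [t <-] := p1_surj x.
  by exists t.
have resI := cone_resolution res df0 h2_inj f0_inj pr_p2_surj prE.
have resN : free_resolution
    (cone_diff (cone_diff d h2 f0 f1) h1 G0 (col_mx G1 w)) (q \o p1).
  apply: (cone_resolution resI) => //=.
    by rewrite !mul_col_mx hG f0G.
  move=> x y xy; apply: j_inj; rewrite -gE linear0 -[LHS]/((g \o p2) x) -G0E xy.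
  exact: exact_mul0.
have [_ _ exN] := resN.
have ex2 := Ext_vanishes_resolution (N_Ext 2 isT) resN.
have ex3 := Ext_vanishes_resolution (N_Ext 3 isT) resN.
exists a2, a1, h2, h1, G0, G1; split=> //.
  exists (q \o p1); split=> // t; rewrite qE.
  split=> [[x [y ->]] | [z ->]].
    by exists (row_mx x y); rewrite mul_row_col.
  by exists (lsubmx z), (rsubmx z); rewrite -mul_row_col hsubmxK.
apply: (presents_dual res F_lin F_surj F_ker df1).
- move=> v dv; have [|z ->] := ex3 v.
    by move=> x /(exN 2)[y ->]; rewrite -mulmxA dv mulmx0.
  exists (usubmx z), (- dsubmx z).
  by rewrite mulmxN -mulNmx -mul_row_col vsubmxK.
- move=> y; split=> [[v fv] | [z ->]]; last first.
    exists (f0 *m usubmx z - w *m dsubmx z).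
    rewrite -[z in LHS]vsubmxK mul_row_col mulmxDr mulmxBr !mulmxA -df0.
    by rewrite mulmxN mulNmx f1G.
  have [|z] := ex2 (col_mx y v).
    move=> x /(exN 1)[t ->]; rewrite -mulmxA mul_row_col mulNmx fv subrr.
    by rewrite mulmx0.
  rewrite /= -[z]vsubmxK mul_row_col mulNmx !mul_col_mx.
  rewrite opp_col_mx add_col_mx => /eq_col_mx[-> _].
  exists (- col_mx (dsubmx z) (usubmx z)).
  by rewrite mulmxN mul_row_col mulNmx opprB.
Qed.

End ShiftSequenceMatrices.

(** * Reduced norms of block matrices *)

(** Rows and columns are permuted alike, so the signs cancel. Two sizes occur because a matrix of
    [a + b] blocks and one assembled from four parts have sizes that are only provably equal. *)
Lemma det_reindex (E : comNzRingType) m m' (e : 'I_m -> 'I_m') (X : 'M[E]_m') :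
  m = m' -> injective e -> \det (mxsub e e X) = \det X.
Proof.
move=> mm'; subst m' => e_inj; pose s := perm e_inj.
have -> : mxsub e e X = row_perm s (col_perm s X).
  by apply/matrixP => i j; rewrite !mxE !permE.
rewrite row_permE col_permE !det_mulmx !det_perm odd_permV mulrCA.
by rewrite -signr_addb addbb mulr1.
Qed.

Section BlockMap.
Context (A : nzRingType) (E : comNzRingType) (w : nat).
Context (phi : {rmorphism A -> 'M[E]_w.+1}).

Definition blockmap a b (X : 'M[A]_(a, b)) :
    'M[E]_(\sum_(k < a) w.+1, \sum_(l < b) w.+1) :=
  \mxblock_(k < a, l < b) phi (X k l).

Lemma blockmap_Rank a b (X : 'M[A]_(a, b)) k l x y :
  blockmap X (tagnat.Rank k x) (tagnat.Rank l y) = phi (X k l) x y.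
Proof.
have := mxblockK (fun k l => phi (X k l)) k l.
by move=> /matrixP/(_ x y); rewrite mxE.
Qed.

Lemma blockmap_mul a b c (X : 'M[A]_(a, b)) (Y : 'M[A]_(b, c)) :
  blockmap (X *m Y) = blockmap X *m blockmap Y.
Proof.
rewrite mul_mxblock; apply: eq_mxblock => k l.
by rewrite mxE rmorph_sum; apply: eq_bigr => j _; rewrite rmorphM.
Qed.

Lemma blockmap1 a : blockmap (1%:M : 'M[A]_a) = 1%:M.
Proof.
rewrite -mxdiagZ; apply: eq_mxblock => k l.
by rewrite mxE; case: eqP => _; rewrite ?conform_mx_id ?rmorph1 ?rmorph0.
Qed.

Lemma blockmap0 a b : blockmap (0 : 'M[A]_(a, b)) = 0.
Proof.
by rewrite -[RHS]mxblock0; apply: eq_mxblock => k l; rewrite mxE rmorph0.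
Qed.

Let block_index a b (s : 'I_(\sum_(k < a) w.+1 + \sum_(k < b) w.+1)) :
    'I_(\sum_(k < a + b) w.+1) :=
  match split s with
  | inl x => @tagnat.Rank (a + b) (fun=> w.+1)
               (lshift b (tagnat.sig1 x)) (tagnat.sig2 x)
  | inr x => @tagnat.Rank (a + b) (fun=> w.+1)
               (rshift a (tagnat.sig1 x)) (tagnat.sig2 x)
  end.

Lemma det_blockmap_block a b (X : 'M[A]_a) (Y : 'M[A]_(a, b))
    (Z : 'M[A]_(b, a)) (W : 'M[A]_b) :
  \det (blockmap (block_mx X Y Z W)) =
  \det (block_mx (blockmap X) (blockmap Y) (blockmap Z) (blockmap W)).
Proof.
rewrite -(@det_reindex E _ _ (@block_index a b)); last 2 first.
- by rewrite !sum_nat_const !card_ord mulnDl.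
- move=> s t; rewrite /block_index.
  have Rank_inj c (x y : 'I_(\sum_(k < c) w.+1)) :
      (tagnat.sig1 x == tagnat.sig1 y) &&
      (tagnat.sig2 x == tagnat.sig2 y :> nat) -> x = y.
    by rewrite -tagnat.eq_Rank !tagnat.sig2K => /eqP/val_inj.
  case: (splitP s) => x sx; case: (splitP t) => y ty /(congr1 val)/eqP;
    rewrite tagnat.eq_Rank -(inj_eq val_inj) /= ?eqn_add2l => xy.
  + by apply: val_inj; rewrite /= sx ty (Rank_inj _ x y).
  + by move: xy; rewrite ltn_eqF //; apply: ltn_addr.
  + by move: xy; rewrite gtn_eqF //; apply: ltn_addr.
  + by apply: val_inj; rewrite /= sx ty (Rank_inj _ x y).
congr (\det _); apply/matrixP => s t; rewrite mxE /block_index.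
case: (split_ordP s) => x ->; case: (split_ordP t) => y ->;
  rewrite ?block_mxEul ?block_mxEur ?block_mxEdl ?block_mxEdr blockmap_Rank;
  by rewrite ?block_mxEul ?block_mxEur ?block_mxEdl ?block_mxEdr mxE.
Qed.

End BlockMap.

(** What the arguments with minors use of the reduced norm, isolated so that they serve both R and
    its opposite. *)
Record norm_like (B A : nzRingType) (N : forall a, 'M[B]_a -> A) : Prop :=
  NormLike {
    normM : forall a (X Y : 'M[B]_a), N a (X *m Y) = N a X * N a Y;
    norm1 : forall a, N a 1%:M = 1;
    norm_central : forall a (X : 'M[B]_a) y, GRing.comm (N a X) y;
    norm_lblock : forall a b (X : 'M[B]_a) (Z : 'M[B]_(b, a)) (Y : 'M[B]_b),
      N (a + b)%N (block_mx X 0 Z Y) = N a X * N b Y;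
    norm_ublock : forall a b (X : 'M[B]_a) (Z : 'M[B]_(a, b)) (Y : 'M[B]_b),
      N (a + b)%N (block_mx X Z 0 Y) = N a X * N b Y }.

Section ReducedNorm.
Context (K : fieldType) (A : falgType K) (nrd : forall a, 'M[A]_a -> A).
Context (nrd_rn : is_reduced_norm nrd).

(** The coordinates of [x], mapped to E, and the zero row both represent the zero tuple, so
    uniqueness in the splitting identifies them. *)
Lemma splitting_inj (E : fieldType) (tau : {rmorphism K -> E}) m
    (n : 'I_m -> nat) (phi : forall i, {rmorphism A -> 'M[E]_((n i).+1)}) x :
  is_splitting tau phi -> (forall i, phi i x = 0) -> x = 0.
Proof.
move=> [phi_lin phi_iso] x0; have xE := coord_vbasis (memvf x).
have [c [_ c_uniq]] := phi_iso (fun=> 0).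
have c0 : c = 0.
  by apply: c_uniq => i; rewrite big1 // => j _; rewrite mxE scale0r.
pose c' : 'rV[E]_(\dim {:A}) := \row_j tau (coord (vbasis {:A}) j x).
have c'0 : c = c'.
  apply: c_uniq => i; apply: etrans (esym (x0 i)) _; rewrite {1}xE rmorph_sum.
  by apply: eq_bigr => j _; rewrite phi_lin mxE.
rewrite xE big1 // => j _; have /rowP/(_ j) := c'0.
rewrite c0 !mxE => /esym/eqP; rewrite fmorph_eq0 => /eqP ->.
by rewrite scale0r.
Qed.

Lemma splitting_eq (E : fieldType) (tau : {rmorphism K -> E}) m
    (n : 'I_m -> nat) (phi : forall i, {rmorphism A -> 'M[E]_((n i).+1)}) x y :
  is_splitting tau phi -> (forall i, phi i x = phi i y) -> x = y.
Proof.
move=> phi_split xy; apply/subr0_eq/(splitting_inj phi_split) => i.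
by rewrite rmorphB xy subrr.
Qed.

Lemma nrd_norm_like : norm_like nrd.
Proof.
have [E [tau [m [n [phi [phi_split nrdE]]]]]] := nrd_rn.
have phi_nrd i a (X : 'M[A]_a) : phi i (nrd X) = (\det (blockmap (phi i) X))%:M.
  by case: (nrdE a X) => _; apply.
split.
- move=> a X Y; apply: (splitting_eq phi_split) => i.
  by rewrite rmorphM !phi_nrd blockmap_mul det_mulmx scalar_mxM.
- move=> a; apply: (splitting_eq phi_split) => i.
  by rewrite phi_nrd blockmap1 det1 [RHS]rmorph1.
- by move=> a X y; case: (nrdE a X) => + _; apply.
- move=> a b X Z Y; apply: (splitting_eq phi_split) => i.
  rewrite rmorphM !phi_nrd det_blockmap_block blockmap0.
  by rewrite det_lblock scalar_mxM.
- move=> a b X Z Y; apply: (splitting_eq phi_split) => i.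
  rewrite rmorphM !phi_nrd det_blockmap_block blockmap0.
  by rewrite det_ublock scalar_mxM.
Qed.

Lemma nrd_unit_regular a b (h : 'M[A]_a) (x : 'M[A]_(b, a)) :
  nrd h \is a GRing.unit -> x *m h = 0 -> x = 0.
Proof.
have [E [tau [m [n [phi [phi_split nrdE]]]]]] := nrd_rn.
move=> h_unit xh; apply/matrixP => k l; rewrite mxE.
apply: (splitting_inj phi_split) => i.
have : blockmap (phi i) h \in unitmx.
  rewrite unitmxE unitfE; apply/eqP => det0.
  have := rmorph_unit (phi i) h_unit; case: (nrdE a h) => _ ->.
  by rewrite -/(blockmap _ _) det0 raddf0 unitr0.
move=> /mulmxK/(_ (blockmap (phi i) x)) /=; rewrite -blockmap_mul xh.
rewrite blockmap0 mul0mx => x0; apply/matrixP => s t.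
by rewrite -blockmap_Rank -x0 !mxE.
Qed.

End ReducedNorm.

Section OrderNorm.
Context (L : idomainType) (A : falgType {fraction L}) (R : algType L).
Context (iota : {rmorphism R -> A}) (nrd : forall a, 'M[A]_a -> A).
Context (iota_inj : injective iota).
Context (nrd_rn : is_reduced_norm nrd).

Lemma nrdl_norm_like : norm_like (nrdl iota nrd).
Proof.
have Nnrd := nrd_norm_like nrd_rn; rewrite /nrdl; split.
- by move=> a X Y; rewrite map_mxM normM.
- by move=> a; rewrite map_mx1 norm1.
- by move=> a X y; apply: norm_central.
- by move=> a b X Z Y; rewrite map_block_mx map_mx0 norm_lblock.
- by move=> a b X Z Y; rewrite map_block_mx map_mx0 norm_ublock.
Qed.

Lemma nrdr_norm_like : norm_like (nrdr iota nrd).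
Proof.
have Nl := nrdl_norm_like; rewrite /nrdr; split.
- move=> a X Y; rewrite -(norm_central Nl) -(normM Nl); congr (nrdl _ _ _).
  apply: trmx_inj.
  by rewrite trmxK (trmx_mul_rev (Y^T : 'M[R]_a) (X^T : 'M[R]_a)) !trmxK.
- move=> a; rewrite -(norm1 Nl a); congr (nrdl _ _ _).
  by apply/matrixP => i j; rewrite !mxE eq_sym; case: (_ == _).
- by move=> a X y; apply: (norm_central Nl).
- move=> a b X Z Y; rewrite -(norm_ublock Nl _ (Z^T)); congr (nrdl _ _ _).
  by rewrite tr_block_mx trmx0.
- move=> a b X Z Y; rewrite -(norm_lblock Nl _ (Z^T)); congr (nrdl _ _ _).
  by rewrite tr_block_mx trmx0.
Qed.

Lemma nrdl_unit_regular a b (h : 'M[R]_a) (x : 'M[R]_(b, a)) :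
  nrdl iota nrd h \is a GRing.unit -> x *m h = 0 -> x = 0.
Proof.
move=> h_unit /(congr1 (map_mx iota)); rewrite map_mxM map_mx0.
move=> /(nrd_unit_regular nrd_rn h_unit)/matrixP x0; apply/matrixP => i j.
by apply: iota_inj; have := x0 i j; rewrite !mxE rmorph0.
Qed.

End OrderNorm.

(** * Fitting ideals and complementary minors *)

Definition glue (T : Type) m n (f : 'I_m -> T) (g : 'I_n -> T)
    (k : 'I_(m + n)) : T :=
  match split k with inl i => f i | inr j => g j end.

Section Span.
Context (A : nzRingType).
Implicit Types C G J : set A.

Lemma spanset0 C G : spanset C G 0.
Proof.
by exists 0%N, (fun=> 0), (fun=> 0); split=> [[]|[]|] //; rewrite big_ord0.
Qed.

Lemma spansetD C G x y : spanset C G x -> spanset C G y -> spanset C G (x + y).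
Proof.
move=> [m [c [g [Cc Gg ->]]]] [n [c' [g' [Cc' Gg' ->]]]].
exists (m + n)%N, (glue c c'), (glue g g'); split.
- by move=> k; rewrite /glue; case: split.
- by move=> k; rewrite /glue; case: split.
rewrite big_split_ord; congr (_ + _); apply: eq_bigr => k _.
  by rewrite /glue (unsplitK (inl k)).
by rewrite /glue (unsplitK (inr k)).
Qed.

Lemma mem_spanset C G c g : C c -> G g -> spanset C G (c * g).
Proof.
move=> Cc Gg; exists 1%N, (fun=> c), (fun=> g); split=> //.
by rewrite big_ord1.
Qed.

Lemma spanset_sub C G J :
  J 0 -> (forall x y, J x -> J y -> J (x + y)) ->
  (forall c g, C c -> G g -> J (c * g)) -> spanset C G `<=` J.
Proof.
move=> J0 JD JM x [n [c [g [Cc Gg ->]]]].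
by apply: big_ind => // k _; apply: JM.
Qed.

Lemma spansetM C G a x :
  (forall c, C c -> C (a * c)) -> spanset C G x -> spanset C G (a * x).
Proof.
move=> aC; apply: (@spanset_sub _ _ (fun x => spanset C G (a * x))).
- by rewrite mulr0; apply: spanset0.
- by move=> y z yC zC; rewrite mulrDr; apply: spansetD.
- by move=> c g Cc Gg; rewrite mulrA; apply: mem_spanset Gg; apply: aC.
Qed.

End Span.

(** [ext e] and [ext f] both list all of ['I_n], the image first; matching positions gives the
    permutation. It turns the rows of a minor into a choice of complementary columns. *)
Lemma extend_perm q n (e f : 'I_q -> 'I_n) :
  injective e -> injective f -> exists s : 'S_n, forall i, s (e i) = f i.
Proof.
move=> e_inj f_inj.
pose im (g : 'I_q -> 'I_n) := map g (enum 'I_q).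
pose ext g := im g ++ [seq x <- enum 'I_n | x \notin im g].
have ext_uniq g : injective g -> uniq (ext g).
  move=> g_inj; rewrite cat_uniq filter_uniq ?enum_uniq // andbT.
  rewrite map_inj_uniq ?enum_uniq //=; apply/hasPn => x.
  by rewrite mem_filter => /andP[].
have ext_all g x : x \in ext g.
  by rewrite mem_cat mem_filter mem_enum andbT orbN.
have ext_size g : injective g -> size (ext g) = n.
  move=> /ext_uniq/card_uniqP <-; rewrite -[RHS]card_ord.
  by apply: eq_card => x; rewrite ext_all.
pose s x := nth x (ext f) (index x (ext e)).
have index_lt x : (index x (ext e) < size (ext f))%N.
  rewrite ext_size //; have := ext_all e x.
  by rewrite -index_mem ext_size.
have s_inj : injective s.
  move=> x y /eqP; rewrite /s (set_nth_default x y) //.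
  rewrite nth_uniq ?ext_uniq // => /eqP xy.
  by rewrite -(nth_index x (ext_all e x)) xy nth_index.
exists (perm s_inj) => i; rewrite permE /s.
rewrite index_cat map_f ?mem_enum // index_map // index_enum_ord.
rewrite nth_cat size_map size_enum_ord ltn_ord (nth_map i) ?size_enum_ord //.
by rewrite nth_ord_enum.
Qed.

Section PresentationMatrices.
Context (B : nzRingType).

Lemma presents_col_mxC (M : lmodType B) a b c (X : 'M[B]_(b, a))
    (Y : 'M[B]_(c, a)) :
  presents (col_mx X Y) M -> presents (col_mx Y X) M.
Proof.
move=> [p [p_surj hp]]; exists p; split=> // x; rewrite hp.
by split=> -[y ->]; exists (row_mx (rsubmx y) (lsubmx y));
   rewrite mul_row_col addrC -mul_row_col hsubmxK.
Qed.

(** The rows [[0, 1]] kill the added generators, so [K], [K'] and [K''] may be arbitrary. *)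
Lemma presents_enlarge (M : lmodType B) p q e a (h : 'M[B]_p) (G : 'M[B]_(q, p))
    (K : 'M[B]_(p, e)) (K' : 'M[B]_(q, e)) (K'' : 'M[B]_(a, e)) :
  presents (col_mx h G) M ->
  presents (col_mx (block_mx h K 0 1%:M) (block_mx G K' 0 K'')) M.
Proof.
move=> [f [f_surj hf]].
have [|f' f'E] := @linear_bundle B 'rV[B]_(p + e) M (f \o lsubmx).
  by move=> c x y /=; rewrite linearP /= linearP.
exists f'; split=> [m | x].
  have [x <-] := f_surj m; exists (row_mx x 0).
  by rewrite f'E /= row_mxKl.
rewrite f'E /= hf; split=> [[z xz] | [y ->]].
  pose z1 := lsubmx z; pose z2 := rsubmx z.
  exists (row_mx (row_mx z1 (rsubmx x - z1 *m K - z2 *m K')) (row_mx z2 0)).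
  rewrite mul_row_col !mul_row_block !mulmx0 !mul0mx !addr0 mulmx1 add_row_mx.
  rewrite -[LHS]hsubmxK xz -[z]hsubmxK mul_row_col; congr row_mx.
  by rewrite -addrA subrK addrC subrK.
exists (row_mx (lsubmx (lsubmx y)) (lsubmx (rsubmx y))).
rewrite -[y in LHS]hsubmxK mul_row_col linearD /=.
rewrite -{1}[lsubmx y]hsubmxK -{1}[rsubmx y]hsubmxK !mul_row_block !row_mxKl.
by rewrite !mulmx0 !addr0 mul_row_col.
Qed.

End PresentationMatrices.

Lemma glue_inj (T : eqType) m n (f : 'I_m -> T) (g : 'I_n -> T) :
  injective f -> injective g -> (forall i j, f i != g j) ->
  injective (glue f g).
Proof.
move=> f_inj g_inj fg i j; rewrite /glue.
case: (split_ordP i) => i' ->; case: (split_ordP j) => j' ->.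
- by move/f_inj ->.
- by move/eqP; rewrite (negPf (fg _ _)).
- by move/esym/eqP; rewrite (negPf (fg _ _)).
- by move/g_inj ->.
Qed.

Lemma rowsub_glue (T : Type) m n a b (f : 'I_m -> 'I_a) (g : 'I_n -> 'I_a)
    (X : 'M[T]_(a, b)) :
  rowsub (glue f g) X = col_mx (rowsub f X) (rowsub g X).
Proof.
by apply/matrixP => i j; rewrite !mxE /glue; case: split => k; rewrite mxE.
Qed.

Lemma rowsub_lshift (T : Type) m n b (X : 'M[T]_(m, b)) (Y : 'M[T]_(n, b)) :
  rowsub (@lshift m n) (col_mx X Y) = X.
Proof. by apply/matrixP => i j; rewrite mxE col_mxEu. Qed.

Lemma rowsub_rshift (T : Type) m n b (X : 'M[T]_(m, b)) (Y : 'M[T]_(n, b)) :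
  rowsub (@rshift m n) (col_mx X Y) = Y.
Proof. by apply/matrixP => i j; rewrite mxE col_mxEd. Qed.

Lemma rowsub_row_mx (T : Type) m n a b (f : 'I_m -> 'I_n) (X : 'M[T]_(n, a))
    (Y : 'M[T]_(n, b)) :
  rowsub f (row_mx X Y) = row_mx (rowsub f X) (rowsub f Y).
Proof.
apply/matrixP => i j; case: (split_ordP j) => k ->.
  by rewrite mxE !row_mxEl mxE.
by rewrite mxE !row_mxEr mxE.
Qed.

Lemma rowsub0 (T : nmodType) m n a (f : 'I_m -> 'I_n) :
  rowsub f (0 : 'M[T]_(n, a)) = 0.
Proof. by apply/matrixP => i j; rewrite !mxE. Qed.

Section FittingIdeals.
Context (A B : nzRingType) (N : forall a, 'M[B]_a -> A) (I : set A).
Context (N_norm : norm_like N).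
Context (I0 : I 0) (ID : forall x y, I x -> I y -> I (x + y)).
Context (IM : forall x y, I x -> I y -> I (x * y)).
Context (IN : forall a (X : 'M[B]_a), I (N X)).

(** Stands for the Fitting ideal of the transpose over the opposite ring; with columns,
    complementary minors are norms of matrices over one ring. *)
Definition colfitt a b (u : 'M[B]_(a, b)) : set A :=
  spanset I [set x | exists g : 'I_a -> 'I_b,
                       injective g /\ x = N (colsub g u)].

Lemma colfitt_sub a b (u : 'M[B]_(a, b)) : colfitt u `<=` I.
Proof. by apply: spanset_sub => // c g Ic [f [_ ->]]; apply: IM. Qed.

Lemma normJ a (X : 'M[B]_a) x : N X * x = x * N X.
Proof. exact: norm_central. Qed.

Lemma norm_perm p (s : 'S_p) : N (perm_mx s) * N (perm_mx s^-1) = 1.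
Proof. by rewrite -(normM N_norm) -perm_mxM mulgV perm_mx1 norm1. Qed.

Section Complement.
Context (p q : nat) (h2 : 'M[B]_p) (h1 : 'M[B]_q) (G0 G1 : 'M[B]_(p, q)).
Context (hG : h2 *m G0 = G1 *m h1).

(** Complete [u = [h2, -G1]] by the unit rows [e] that pick out the minor of [v]. Multiplied by
    [[1, G0; 0, h1]] it is lower triangular with diagonal blocks [h2] and the minor of [v]; with its
    columns permuted it is upper triangular with diagonal blocks the minor of [u] and 1. *)
Lemma complementary_minors (s : 'S_(p + q)) :
  N h2 * N (rowsub (s \o @rshift p q) (col_mx G0 h1)) * N (perm_mx s^-1) =
  N h1 * N (colsub (s \o @lshift p q) (row_mx h2 (- G1))).
Proof.
set v := col_mx G0 h1; set u := row_mx h2 (- G1).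
pose e := rowsub (s \o @rshift p q) (1%:M : 'M[B]_(p + q)).
have uW : col_mx u e *m block_mx 1%:M G0 0 h1 =
    block_mx h2 0 (lsubmx e) (rowsub (s \o @rshift p q) v).
  rewrite block_mxEh mul_mx_row !mul_col_mx block_mxEh.
  rewrite mul_row_col mulmx1 mulmx0 addr0 [u *m v]mul_row_col mulNmx hG subrr.
  rewrite -{1}[e]hsubmxK mul_row_col mulmx1 mulmx0 addr0.
  by rewrite /e mul_rowsub_mx mul1mx.
move: uW; clearbody u v => uW.
have uC : col_mx u e *m perm_mx s^-1 =
    block_mx (colsub (s \o @lshift p q) u) (colsub (s \o @rshift p q) u) 0 1%:M.
  rewrite -col_permE; apply/matrixP => i j; rewrite mxE.
  case: (split_ordP i) => i' ->; case: (split_ordP j) => j' ->.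
  + by rewrite col_mxEu block_mxEul mxE.
  + by rewrite col_mxEu block_mxEur mxE.
  + by rewrite col_mxEd block_mxEdl !mxE (inj_eq perm_inj) eq_rlshift.
  + by rewrite col_mxEd block_mxEdr !mxE (inj_eq perm_inj) eq_rshift.
have /(congr1 (fun x => x * N (perm_mx s^-1))) :=
  normM N_norm (col_mx u e) (block_mx 1%:M G0 0 h1).
rewrite uW norm_lblock // norm_ublock // norm1 // mul1r => ->.
rewrite -mulrA [N h1 * _]normJ mulrA -(normM N_norm) uC norm_ublock //.
by rewrite norm1 // mulr1 normJ.
Qed.

Lemma fitt_complement x : fitt N I (col_mx G0 h1) x ->
  exists2 y, colfitt (row_mx h2 (- G1)) y & N h2 * x = N h1 * y.
Proof.
apply: (@spanset_sub _ _ _ [set x | exists2 y, colfitt (row_mx h2 (- G1)) y &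
                                      N h2 * x = N h1 * y]).
- by exists 0; [exact: spanset0 | rewrite !mulr0].
- move=> a b [y yF ay] [z zF bz]; exists (y + z); first exact: spansetD.
  by rewrite !mulrDr ay bz.
move=> c _ Ic [f [f_inj ->]].
have [s sf] := extend_perm (@rshift_inj p q) f_inj.
have sub_s : rowsub f (col_mx G0 h1) =
             rowsub (s \o @rshift p q) (col_mx G0 h1).
  by apply: eq_rowsub => i; rewrite /= sf.
exists (c * N (perm_mx s) * N (colsub (s \o @lshift p q) (row_mx h2 (- G1)))).
  apply: mem_spanset; first by apply: IM.
  by eexists; split; last by []; apply: inj_comp perm_inj (@lshift_inj _ _).
set Nu := N (colsub _ _); set Nv := N (rowsub _ _).
have -> : N h2 * (c * Nv) = c * (N h2 * Nv) by rewrite normJ -mulrA normJ.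
have -> : N h1 * (c * N (perm_mx s) * Nu) = c * (N h1 * Nu * N (perm_mx s)).
  rewrite normJ -!mulrA; congr (c * _).
  by rewrite [RHS]normJ mulrA (normJ (perm_mx s)).
rewrite -complementary_minors -[_ * N (perm_mx s)]mulrA.
by rewrite [N (perm_mx s^-1) * _]normJ norm_perm mulr1 /Nv sub_s.
Qed.

End Complement.

Lemma fitt_sub_of_minors a b (h : 'M[B]_(b, a)) c d (h' : 'M[B]_(d, c)) :
  (forall f : 'I_a -> 'I_b, injective f ->
     exists2 g : 'I_c -> 'I_d,
       injective g & N (rowsub f h) = N (rowsub g h')) ->
  fitt N I h `<=` fitt N I h'.
Proof.
move=> minors.
apply: spanset_sub; [exact: spanset0 | by move=> *; apply: spansetD |].
move=> c' _ Ic' [f [/minors[g g_inj ->] ->]]; apply: mem_spanset => //.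
by exists g.
Qed.

Section Enlarge.
Context (p q : nat) (h2 : 'M[B]_p) (h1 : 'M[B]_q) (G0 G1 : 'M[B]_(p, q)).
Context (hG : h2 *m G0 = G1 *m h1).

(** Both sets of generators are used at once. The relations writing new generators in old ones
    complete [h1], the others complete [G0]; the completed [h1] and [h2] are triangular with
    identity as new diagonal block. *)
Lemma enlarge_presentation (M : lmodType B) a b (h : 'M[B]_(b, a)) :
  presents (col_mx G0 h1) M -> presents h M ->
  exists (Kl : 'M[B]_(b + q, p)) (Kr : 'M[B]_(b + q, q)) (K : 'M[B]_(b + q, a))
         (X' : 'M[B]_(a, q)) (G0' : 'M[B]_(p + (b + q), q + a)),
    let h1' := block_mx h1 0 X' 1%:M in
    [/\ block_mx h2 0 Kl 1%:M *m G0' = block_mx G1 0 Kr K *m h1',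
        presents (col_mx G0' h1') M,
        fitt N I (col_mx G0 h1) `<=` fitt N I (col_mx G0' h1') &
        fitt N I h `<=` fitt N I (col_mx G0' h1')].
Proof.
move=> [f [f_surj vf]] [f' [f'_surj hf']].
have [X fX] := lift_free f f'_surj; have [X' fX'] := lift_free f' f_surj.
(* The rows of [[Q, K]] are the relations [h] between new generators, then those writing each old
   generator in new ones. *)
pose Q : 'M[B]_(b + q, q) := col_mx 0 1%:M.
pose K : 'M[B]_(b + q, a) := col_mx h (- X).
have fK z : f (z *m Q) + f' (z *m K) = 0.
  rewrite -[z]hsubmxK !mul_row_col mulmx0 add0r mulmx1 mulmxN linearB /= fX.
  by rewrite (exact_mul0 _ hf') sub0r subrr.
(* Eliminating the new generators leaves relations between old ones; their coordinates on [[G0; h1]]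
   are [Kr] and, up to sign, [Kl]. *)
have [|K1 K1E] := lift_exact (X := Q + K *m X') vf.
  by move=> x; rewrite mulmxDr mulmxA linearD /= fX' fK.
pose G0' := block_mx G0 0 Q K; pose h1' := block_mx h1 0 (- X') 1%:M.
exists (- lsubmx K1), (rsubmx K1), K, (- X'), G0'; split.
- rewrite !mulmx_block !mul0mx !mulmx0 !addr0 !add0r hG !mul1mx !mulmx1.
  congr block_mx; rewrite mulNmx mulmxN addrC; apply/eqP.
  rewrite subr_eq addrAC eq_sym subr_eq eq_sym K1E.
  by rewrite -{1}[K1]hsubmxK mul_row_col addrC.
- have [|g gE] := @linear_bundle B 'rV[B]_(q + a) M
                    (fun x => f (lsubmx x) + f' (rsubmx x)).
    move=> c x y; rewrite !linearP /= scalerDr.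
    by rewrite addrACA.
  exists g; split=> [m | x].
    have [x <-] := f_surj m; exists (row_mx x 0).
    by rewrite gE row_mxKl row_mxKr linear0 addr0.
  rewrite gE; split=> [gx | [z ->]].
    have /vf[z xz] : f (lsubmx x + rsubmx x *m X') = 0.
      by rewrite linearD /= fX'.
    exists (row_mx (row_mx (lsubmx z) 0) (row_mx (rsubmx z) (rsubmx x))).
    rewrite mul_row_col !mul_row_block !mul0mx !mulmx0 !addr0 add0r mulmx1.
    rewrite add_row_mx add0r mulmxN addrA -mul_row_col hsubmxK -xz addrK.
    by rewrite hsubmxK.
  rewrite -[z]hsubmxK mul_row_col linearD /= linearD /= !linearD /= addrACA.
  rewrite -[lsubmx z]hsubmxK -[rsubmx z]hsubmxK !mul_row_block.
  rewrite !row_mxKl !row_mxKr !mulmx0 !add0r mulmx1 !linearD /= mulmxN.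
  rewrite linearN /= fX'.
  have f_G0 y : f (y *m G0) = 0.
    by apply/vf; exists (row_mx y 0); rewrite mul_row_col mul0mx addr0.
  have f_h1 y : f (y *m h1) = 0.
    by apply/vf; exists (row_mx 0 y); rewrite mul_row_col mul0mx add0r.
  by rewrite f_G0 f_h1 !add0r fK add0r addNr.
- apply: fitt_sub_of_minors => g g_inj.
  (* A minor of [[G0; h1]] is completed by all rows of [[-X', 1]]. *)
  pose top := glue (@lshift (p + (b + q)) (q + a) \o @lshift p (b + q))
                   (@rshift (p + (b + q)) (q + a) \o @lshift q a).
  exists (glue (top \o g) (@rshift (p + (b + q)) (q + a) \o @rshift q a)).
    apply: glue_inj => [||i j].
    + apply: inj_comp g_inj; apply: glue_inj => [||i j].
      * by apply: inj_comp; apply: lshift_inj.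
      * by apply: inj_comp; [apply: rshift_inj | apply: lshift_inj].
      * by rewrite /= eq_lrshift.
    + by apply: inj_comp; apply: rshift_inj.
    + rewrite /= /top /glue /=.
      by case: (split (g i)) => k; rewrite ?eq_lrshift // eq_rshift eq_lrshift.
  have topE : rowsub top (col_mx G0' h1') = row_mx (col_mx G0 h1) 0.
    rewrite rowsub_glue (rowsub_comp (@lshift _ _)) (rowsub_comp (@rshift _ _)).
    rewrite rowsub_lshift rowsub_rshift /G0' /h1' !block_mxEv !rowsub_lshift.
    by rewrite -block_mxEv block_mxEh col_mx0.
  rewrite rowsub_glue (rowsub_comp top) topE (rowsub_comp (@rshift _ _)).
  rewrite rowsub_rshift /h1' [block_mx _ _ _ 1%:M]block_mxEv rowsub_rshift.
  by rewrite rowsub_row_mx rowsub0 -block_mxEv norm_lblock // norm1 // mulr1.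
- apply: fitt_sub_of_minors => g g_inj.
  (* A minor of [h] is completed by the rows [[1, -X]] of [[Q, K]], put first to make the matrix
     upper triangular. *)
  pose bot := @lshift (p + (b + q)) (q + a) \o (@rshift p (b + q)).
  exists (glue (bot \o @rshift b q) (bot \o (@lshift b q \o g))).
    have bot_inj : injective bot.
      by apply: inj_comp; [apply: lshift_inj | apply: rshift_inj].
    apply: glue_inj => [||i j].
    + by apply: (inj_comp bot_inj); apply: rshift_inj.
    + by apply: (inj_comp bot_inj); apply: inj_comp g_inj; apply: lshift_inj.
    + by rewrite (inj_eq bot_inj) /= eq_rlshift.
  have botE : rowsub bot (col_mx G0' h1') = row_mx Q K.
    rewrite (rowsub_comp (@lshift _ _)) rowsub_lshift /G0' block_mxEv.
    by rewrite rowsub_rshift.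
  rewrite rowsub_glue (rowsub_comp bot) botE (rowsub_comp bot) botE.
  rewrite -block_mxEh -/(block_mx _ _ _ _) block_mxEv rowsub_rshift.
  rewrite (rowsub_comp (@lshift _ _)) rowsub_lshift.
  by rewrite rowsub_row_mx rowsub0 -block_mxEv norm_ublock // norm1 // mul1r.
Qed.

Lemma fitting_ideal_transfer (M : lmodType B) J :
  presents (col_mx G0 h1) M -> fitting_ideal N I M J ->
  exists e a (Kl : 'M[B]_(e, p)) (Kr : 'M[B]_(e, q)) (K : 'M[B]_(e, a)),
    forall x, J x ->
    exists2 y, colfitt (row_mx (block_mx h2 0 Kl 1%:M) (- block_mx G1 0 Kr K)) y
      & N h2 * x = N h1 * y.
Proof.
move=> vM [a [b [h [hM ->]]]].
have [Kl [Kr [K [X' [G0' [hG' _ _ sub]]]]]] := enlarge_presentation vM hM.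
exists (b + q)%N, a, Kl, Kr, K => x /sub/(fitt_complement hG')[y yF].
by rewrite !norm_lblock // !norm1 // !mulr1; exists y.
Qed.

End Enlarge.

(** An enlarged presentation has the shape of the given one, so it can be enlarged again to absorb
    the second ideal. *)
Lemma fitting_ideal_directed p q (h2 : 'M[B]_p) (h1 : 'M[B]_q)
    (G0 G1 : 'M[B]_(p, q)) (M : lmodType B) J J' :
  h2 *m G0 = G1 *m h1 -> presents (col_mx G0 h1) M ->
  fitting_ideal N I M J -> fitting_ideal N I M J' ->
  exists K, [/\ fitting_ideal N I M K, J `<=` K & J' `<=` K].
Proof.
move=> hG vM [a [b [h [hM ->]]]] [a' [b' [h' [hM' ->]]]].
have [Kl [Kr [K [X' [G0' [hG' vM' _ sub]]]]]] := enlarge_presentation hG vM hM.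
have [_ [_ [_ [X'' [G0'' [_ vM'' sub' sub'']]]]]] :=
  enlarge_presentation hG' vM' hM'.
eexists; split; first by do 3!eexists; split; [exact: vM'' | reflexivity].
  exact: subset_trans sub sub'.
exact: sub''.
Qed.

(** The case [p = 0] of complementary minors: the empty [h2] has norm 1, so the transfer puts every
    Fitting ideal of P inside [N h] times [I]. *)
Lemma fittmax_square (P : lmodType B) q (h : 'M[B]_q) : I 1 ->
  presents h P -> fittmax N I P = [set x | exists2 z, I z & x = N h * z].
Proof.
move=> I1 hP; set F := [set x | _].
have hP' : presents (col_mx (0 : 'M_(0, q)) h) P.
  case: hP => f [f_surj hf]; exists f; split=> // x; rewrite hf.
  split=> -[y ->].
    by exists (row_mx 0 y); rewrite mul_row_col mul0mx add0r.
  by exists (rsubmx y); rewrite -{1}[y]hsubmxK mul_row_col mulmx0 add0r.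
have max_F J : fitting_ideal N I P J -> J `<=` F.
  move=> PJ x Jx; have h0 : 1%:M *m 0 = 0 *m h :> 'M_(0, q).
    by rewrite [LHS]flatmx0 [RHS]flatmx0.
  have [e [a [Kl [Kr [K /(_ x Jx)[y /colfitt_sub Iy]]]]]] :=
    fitting_ideal_transfer h0 hP' PJ.
  by rewrite norm1 // mul1r => ->; exists y.
have hF : fitt N I h = F.
  apply/seteqP; split.
    by apply: max_F; do 3!eexists; split; first exact: hP.
  move=> _ [z Iz ->]; rewrite normJ; apply: mem_spanset => //.
  by exists id; split=> //; rewrite mxsub_id.
have PF : fitting_ideal N I P F by exists q, q, h.
apply: xget_unique => [|J [PJ J_max]]; last first.
  by rewrite [RHS](J_max F) //; apply: max_F.
by split=> // J PJ FJ; apply/seteqP; split=> //; apply: max_F.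
Qed.

Lemma fittmax_submodule (M : lmodType B) :
  [/\ fittmax N I M 0,
      forall x y, fittmax N I M x -> fittmax N I M y -> fittmax N I M (x + y) &
      forall c x, I c -> fittmax N I M x -> fittmax N I M (c * x)].
Proof.
rewrite /fittmax; case: xgetP => [J _ [[a [b [h [_ ->]]]] _] | _].
  split; [exact: spanset0 | exact: spansetD |].
  by move=> c x Ic; apply: spansetM => c'; apply: IM.
by split=> [|x y -> ->|c x _ ->] //=; rewrite ?addr0 ?mulr0.
Qed.

End FittingIdeals.

(** * Comparison of maximal Fitting ideals *)

Section MaximalMembers.
Context (A : nzRingType).
Implicit Types (F : set (set A)) (J : set A) (c : A).

Definition maximal_member F J := F J /\ forall J', F J' -> J `<=` J' -> J' = J.

Definition directed F :=
  forall J J', F J -> F J' -> exists K, [/\ F K, J `<=` K & J' `<=` K].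

Definition scaled_le c c' J J' :=
  forall x, J x -> exists2 y, J' y & c * x = c' * y.

Definition scaled_dominated c c' F F' :=
  forall J, F J -> exists2 J', F' J' & scaled_le c c' J J'.

Lemma maximal_member_ge F J K :
  directed F -> maximal_member F J -> F K -> K `<=` J.
Proof.
move=> F_dir [FJ J_max] FK; have [X [FX JX KX]] := F_dir _ _ FJ FK.
by rewrite -(J_max X).
Qed.

(** By directedness [J] is greatest in [F]. An element of some [K] above [J'] passes into [J] and
    from there into [J']; cancelling [c'] shows that the same element arrives. *)
Lemma maximal_member_scaled F F' c c' J :
  injective ( *%R c') -> directed F ->
  scaled_dominated c c' F F' -> scaled_dominated c' c F' F ->
  maximal_member F J -> exists2 J', maximal_member F' J' & scaled_le c c' J J'.
Proof.
move=> c'_inj F_dir FF' F'F J_max; have [FJ _] := J_max.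
have [J' F'J' JJ'] := FF' J FJ; exists J' => //; split=> // K F'K J'K.
apply/seteqP; split=> // x Kx.
have [K' FK' KK'] := F'F K F'K; have [y K'y xy] := KK' x Kx.
have [z J'z yz] := JJ' y (maximal_member_ge F_dir J_max FK' K'y).
by rewrite (c'_inj x z) // xy.
Qed.

(* When there is no maximal member in one family there is none in the other,
   and both sides take the default value. *)
Lemma xget_maximal_scaled F F' c c' :
  injective ( *%R c) -> injective ( *%R c') -> directed F -> directed F' ->
  scaled_dominated c c' F F' -> scaled_dominated c' c F' F ->
  scaled_le c c' (xget [set 0] (maximal_member F))
                 (xget [set 0] (maximal_member F')).
Proof.
move=> c_inj c'_inj F_dir F'_dir FF' F'F.
case: xgetP => [J _ J_max | noF].
  have [J' J'_max JJ'] := maximal_member_scaled c'_inj F_dir FF' F'F J_max.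
  rewrite (xget_unique _ J'_max) // => K K_max; apply/seteqP.
  split; first exact: maximal_member_ge F'_dir J'_max K_max.1.
  exact: maximal_member_ge F'_dir K_max J'_max.1.
rewrite xgetPN => [x -> | J' J'_max]; first by exists 0; rewrite ?mulr0.
by have [J /noF] := maximal_member_scaled c_inj F'_dir F'F FF' J'_max.
Qed.

End MaximalMembers.

(** * Reduced norms and Fitting ideals over an order *)

Section FittingInvariants.
Context (L : idomainType) (A : falgType {fraction L}) (R : algType L).
Context (iota : {rmorphism R -> A}) (iota_order : is_order iota).
Context (S : set L) (S0 : ~ S 0) (S1 : S 1).
Context (SM : forall s t, S s -> S t -> S (s * t)).
Context (nrd : forall a, 'M[A]_a -> A) (nrd_rn : is_reduced_norm nrd).

Local Notation N := (nrdl iota nrd).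
Local Notation N' := (nrdr iota nrd).
Local Notation I := (IR iota nrd).
Local Notation Nl := (nrdl_norm_like iota nrd_rn).
Local Notation Nr := (nrdr_norm_like iota nrd_rn).

Lemma order_inj : injective iota. Proof. by case: iota_order. Qed.

Lemma order_alg (l : L) : iota l%:A = (tofrac l)%:A.
Proof. by case: iota_order. Qed.

Lemma S_regular s (x : R) : S s -> s%:A * x = 0 -> x = 0.
Proof.
move=> Ss /(congr1 iota); rewrite rmorphM rmorph0 order_alg mulr_algl => /eqP.
rewrite scaler_eq0 tofrac_eq0 => /orP[/eqP s0|/eqP].
  by case: S0; rewrite -s0.
by rewrite -[RHS](rmorph0 iota) => /order_inj.
Qed.

Lemma order_center z : ring_center z -> ring_center (iota z).
Proof.
move=> z_central x; have [_ _ _ /(_ x)[l [r [_ ->]]]] := iota_order.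
by rewrite /GRing.comm -scalerAr -scalerAl -!rmorphM z_central.
Qed.

Lemma IR0 : I 0. Proof. exact: spanset0. Qed.

Lemma IRD x y : I x -> I y -> I (x + y). Proof. exact: spansetD. Qed.

Lemma IR_norm a (X : 'M[R]_a) : I (N X).
Proof.
have center1 : (iota @` @ring_center R) 1.
  exists 1; last by rewrite rmorph1.
  by move=> x; apply/commr_sym/commr1.
case: a X => [|a] X; last first.
  by rewrite -[N X]mul1r; apply: mem_spanset => //; exists a.+1, X.
(* Generators of [I] have positive size; the empty matrix has the same norm 1 as the identity of
   size 1. *)
have -> : N X = 1 * N (1%:M : 'M_1).
  rewrite !(norm1 Nl) mul1r (_ : X = 1%:M) ?(norm1 Nl) //.
  by rewrite [LHS]flatmx0 [RHS]flatmx0.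
by apply: mem_spanset => //; exists 1%N, 1%:M.
Qed.

Lemma IR_normr a (X : 'M[R^c]_a) : I (N' X).
Proof. exact: IR_norm. Qed.

Lemma IR1 : I 1.
Proof. by rewrite -(norm1 Nl 0); apply: IR_norm. Qed.

Lemma IR_central z : I z -> ring_center z.
Proof.
apply: (@spanset_sub _ _ _ (@ring_center A)) => [x|x y xc yc z'|].
- exact/commr_sym/commr0.
- by apply/commr_sym/commrD; apply/commr_sym.
move=> _ _ [c c_central <-] [a [X [_ ->]]] x; apply/commr_sym/commrM.
  exact/commr_sym/order_center.
exact/commr_sym/(norm_central Nl).
Qed.

Lemma IRM x y : I x -> I y -> I (x * y).
Proof.
move=> Ix Iy; move: x Ix; apply: (@spanset_sub _ _ _ [set x | I (x * y)]).
- by rewrite /= mul0r; apply: IR0.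
- by move=> a b /= Ia Ib; rewrite mulrDl; apply: IRD.
move=> _ _ [c c_central <-] [a [X [_ ->]]] /=.
move: y Iy; apply: (@spanset_sub _ _ _ [set y | I (_ * _ * y)]).
- by rewrite /= mulr0; apply: IR0.
- by move=> u v /= Iu Iv; rewrite mulrDr; apply: IRD.
move=> _ _ [c' c'_central <-] [a' [X' [a'_gt0 ->]]] /=.
rewrite -mulrA [N X * _]mulrA (norm_central Nl X) -mulrA mulrA -rmorphM.
(* A product of norms is the norm of a block diagonal matrix. *)
rewrite -(norm_lblock Nl X 0 X'); apply: mem_spanset.
  exists (c * c') => // x; apply/commr_sym/commrM; exact/commr_sym.
by exists (a + a')%N, (block_mx X 0 0 X'); rewrite ltn_addl.
Qed.

Lemma norm_scalar_unit a s : S s -> N ((s%:A)%:M : 'M[R]_a) \is a GRing.unit.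
Proof.
move=> Ss; have Nn := nrd_norm_like nrd_rn.
have s_neq0 : tofrac s != 0 :> {fraction L}.
  by rewrite tofrac_eq0; apply/eqP => s0; case: S0; rewrite -s0.
have inv (x y : {fraction L}) : x * y = 1 ->
    nrd ((x%:A)%:M : 'M[A]_a) * nrd ((y%:A)%:M : 'M[A]_a) = 1.
  move=> xy; rewrite -(normM Nn) -scalar_mxM -scalerAl mul1r scalerA xy.
  by rewrite scale1r (norm1 Nn).
rewrite /nrdl map_scalar_mx /= order_alg.
apply/unitrP; exists (nrd (((tofrac s)^-1%:A)%:M : 'M[A]_a)).
by split; apply: inv; rewrite ?mulVf ?mulfV.
Qed.

(** Denominators in [localized_IR] are norms of scalars of size 1; scalar matrices of any size are
    brought to that form. *)
Lemma norm_scalar_mx a s :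
  N ((s%:A)%:M : 'M[R]_a) = N (((s ^+ a)%:A)%:M : 'M[R]_1).
Proof.
elim: a => [|a IHa].
  rewrite expr0 scale1r (norm1 Nl).
  rewrite (_ : (s%:A)%:M = 1%:M) ?(norm1 Nl) //.
  by rewrite [LHS]flatmx0 [RHS]flatmx0.
rewrite -[a.+1]/(1 + a)%N scalar_mx_block (norm_lblock Nl) IHa -(normM Nl).
by rewrite -scalar_mxM -scalerAl mul1r scalerA -exprS.
Qed.

(** A scalar killing P factors as [k h], so [N k] times [N h] is the norm of a scalar matrix. Hence
    [N h] is a unit, and its inverse has a denominator allowed in [localized_IR]. *)
Lemma norm_inverse P a (h : 'M[R]_a) : in_P S P -> presents h P ->
  exists (k : 'M[R]_a) s,
    [/\ S s, N h \is a GRing.unit &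
        (N h)^-1 = N k / N ((s%:A)%:M : 'M[R]_1)].
Proof.
move=> [P_M _] hP; have [s [Ss sP]] := in_M_annihilator S1 SM P_M.
have [k kh] := presents_annihilated (fun y => alg_central s y) hP sP.
have Ssa : S (s ^+ a).
  by elim: a {h hP k kh} => // a IHa; rewrite exprS; apply: SM.
have NkNh : N k * N h = N (((s ^+ a)%:A)%:M : 'M[R]_1).
  by rewrite -norm_scalar_mx kh (normM Nl).
have s_unit := @norm_scalar_unit 1 _ Ssa.
have hC x : N h * x = x * N h by apply: (norm_central Nl).
have inv : N h * (N k / N (((s ^+ a)%:A)%:M : 'M[R]_1)) = 1.
  by rewrite mulrA hC NkNh mulrV.
have h_unit : N h \is a GRing.unit.
  by apply/unitrP; eexists; split; last exact: inv; rewrite -hC.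
exists k, (s ^+ a); split=> //.
by apply: (mulrI h_unit); rewrite inv mulrV.
Qed.

Lemma Fittmaxl_square P a (h : 'M[R]_a) :
  presents h P -> Fittmaxl iota nrd P = [set x | exists2 z, I z & x = N h * z].
Proof. exact: (fittmax_square Nl IR0 IRD IRM IR_norm IR1). Qed.

(** [Omega_inv] is a choice, so uniqueness is needed too: multiplication by [N h], a generator of
    the ideal of P, determines any inverse [Y]. *)
Lemma Omega_inv_square P a (h : 'M[R]_a) : in_P S P -> presents h P ->
  Omega_inv iota nrd S (Fittmaxl iota nrd P) =
  [set x | exists2 z, I z & x = (N h)^-1 * z].
Proof.
move=> PP hP; have [k [s [Ss h_unit hV]]] := norm_inverse PP hP.
rewrite (Fittmaxl_square hP); set F := [set x | _].
have hVC x : (N h)^-1 * x = x * (N h)^-1.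
  by apply/commr_sym/commrV/commr_sym/(norm_central Nl).
apply: xget_unique.
  split.
    exists [:: (N h)^-1]; split.
      move=> x /=; rewrite inE => /eqP ->.
      by exists (N k), s; split=> //; apply: IR_norm.
    apply/seteqP; split=> [_ [z Iz ->] | ].
      by rewrite hVC; apply: mem_spanset; rewrite //= inE.
    apply: spanset_sub => [|x y [u Iu ->] [v Iv ->]|c x Ic /=].
    - by exists 0; [exact: IR0 | rewrite mulr0].
    - by exists (u + v); [exact: IRD | rewrite mulrDr].
    by rewrite inE => /eqP ->; exists c; rewrite ?hVC.
  apply/seteqP; split=> [|z Iz].
    apply: spanset_sub; [exact: IR0 | exact: IRD |].
    move=> _ _ [u Iu ->] [v Iv ->]; rewrite hVC -mulrA mulKr //.
    exact: IRM.
  have -> : z = (N h)^-1 * z * (N h * 1) by rewrite mulr1 hVC mulrVK.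
  apply: mem_spanset; first by exists z.
  by exists 1; [exact: IR1 |].
move=> Y [[g [g_loc YE]] YF]; apply/seteqP; split=> [y Yy|_ [z Iz ->]].
  have Iyh : I (y * N h).
    rewrite -YF; apply: mem_spanset => //.
    by exists 1; [exact: IR1 | rewrite mulr1].
  by exists (y * N h) => //; rewrite hVC mulrK.
rewrite -YF in Iz; move: z Iz.
apply: (@spanset_sub _ _ _ [set z | Y ((N h)^-1 * z)]) => /=.
- by rewrite mulr0 YE; apply: spanset0.
- by move=> u v; rewrite mulrDr YE; apply: spansetD.
move=> y _ Yy [v Iv ->]; rewrite hVC -mulrA [N h * v](norm_central Nl) mulrK //.
have -> : y * v = v * y by rewrite (IR_central Iv).
by rewrite YE in Yy *; apply: spansetM Yy => c; apply: IRM.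
Qed.

Lemma Omega_mul_square P2 P1 a2 a1 (h2 : 'M[R]_a2) (h1 : 'M[R]_a1)
    (F : set A) :
  in_P S P1 -> presents h2 P2 -> presents h1 P1 ->
  F 0 -> (forall x y, F x -> F y -> F (x + y)) ->
  (forall c x, I c -> F x -> F (c * x)) ->
  Omega_mul (Omega_mul (Omega_inv iota nrd S (Fittmaxl iota nrd P1))
                       (Fittmaxl iota nrd P2)) F =
  [set x | exists2 y, F y & x = (N h1)^-1 * N h2 * y].
Proof.
move=> PP1 hP2 hP1 F0 FD FM; rewrite (Omega_inv_square PP1 hP1).
rewrite (Fittmaxl_square hP2).
have h1VC x : (N h1)^-1 * x = x * (N h1)^-1.
  by apply/commr_sym/commrV/commr_sym/(norm_central Nl).
have h2C x : N h2 * x = x * N h2 by apply: (norm_central Nl).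
apply/seteqP; split; last first.
  move=> _ [y Fy ->]; apply: mem_spanset => //; apply: mem_spanset.
    by exists 1; [exact: IR1 | rewrite mulr1].
  by exists 1; [exact: IR1 | rewrite mulr1].
apply: spanset_sub => [|x y [u Fu ->] [v Fv ->]|x y xI Fy].
- by exists 0; rewrite ?mulr0.
- by exists (u + v); [exact: FD | rewrite mulrDr].
suff [z Iz ->] : exists2 z, I z & x = (N h1)^-1 * N h2 * z.
  by exists (z * y); [exact: FM | rewrite mulrA].
move: x xI; apply: (@spanset_sub _ _ _ [set x | exists2 z, I z & x = _ * z]).
- by exists 0; [exact: IR0 | rewrite mulr0].
- move=> u v [a Ia ->] [b Ib ->].
  by exists (a + b); [exact: IRD | rewrite mulrDr].
move=> _ _ [u Iu ->] [v Iv ->]; exists (u * v); first exact: IRM.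
by rewrite -!mulrA (h2C v) (h2C (u * v)) !mulrA.
Qed.

(** The partner of an enlarged presentation of M, once transposed, has the shape of
    [presents_enlarge], so its Fitting ideal belongs to the family of the dual. *)
Lemma fitting_ideal_dominated M Mstar a2 a1 (h2 : 'M[R]_a2) (h1 : 'M[R]_a1)
    (G0 G1 : 'M[R]_(a2, a1)) :
  h2 *m G0 = G1 *m h1 -> presents (col_mx G0 h1) M ->
  presents ((row_mx h2 (- G1))^T : 'M[R^c]_(_, _)) Mstar ->
  scaled_dominated (N h2) (N h1)
    (fitting_ideal N I M) (fitting_ideal N' I Mstar).
Proof.
move=> hG vM uM J JM.
have [e [a [Kl [Kr [K KE]]]]] :=
  fitting_ideal_transfer Nl IRM IR_norm hG vM JM.
pose u' := row_mx (block_mx h2 0 Kl 1%:M) (- block_mx G1 0 Kr K).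
exists (fitt N' I (u'^T : 'M[R^c]_(_, _))).
  exists (a2 + e)%N, (a2 + e + (a1 + a))%N, (u'^T : 'M[R^c]_(_, _)); split=> //.
  rewrite tr_row_mx in uM.
  have := @presents_enlarge R^c _ _ _ _ _ _ _ Kl^T (- Kr)^T (- K)^T uM.
  by rewrite /u' opp_block_mx oppr0 tr_row_mx !tr_block_mx !trmx0 tr_scalar_mx.
move=> x Jx; have [y yF xy] := KE x Jx; exists y => //.
move: yF.
apply: spanset_sub; [exact: spanset0 | by move=> *; apply: spansetD |].
move=> c _ Ic [g [g_inj ->]]; apply: mem_spanset => //; exists g; split=> //.
by rewrite /nrdr; congr (nrdl _ _ _); apply/matrixP => i j; rewrite !mxE.
Qed.

Lemma fitting_ideal_dominatedr (M : lmodType R^c) (Mstar : lmodType R) a2 a1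
    (h2 : 'M[R^c]_a2) (h1 : 'M[R^c]_a1) (G0 G1 : 'M[R^c]_(a2, a1)) :
  h2 *m G0 = G1 *m h1 -> presents (col_mx G0 h1) M ->
  presents ((row_mx h2 (- G1))^T : 'M[R]_(_, _)) Mstar ->
  scaled_dominated (N' h2) (N' h1)
    (fitting_ideal N' I M) (fitting_ideal N I Mstar).
Proof.
move=> hG vM uM J JM.
have [e [a [Kl [Kr [K KE]]]]] :=
  fitting_ideal_transfer Nr IRM IR_normr hG vM JM.
pose u' := row_mx (block_mx h2 0 Kl 1%:M) (- block_mx G1 0 Kr K).
exists (fitt N I (u'^T : 'M[R]_(_, _))).
  exists (a2 + e)%N, (a2 + e + (a1 + a))%N, (u'^T : 'M[R]_(_, _)); split=> //.
  rewrite tr_row_mx in uM.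
  have := @presents_enlarge R _ _ _ _ _ _ _ Kl^T (- Kr)^T (- K)^T uM.
  by rewrite /u' opp_block_mx oppr0 tr_row_mx !tr_block_mx !trmx0 tr_scalar_mx.
move=> x Jx; have [y yF xy] := KE x Jx; exists y => //.
move: yF.
apply: spanset_sub; [exact: spanset0 | by move=> *; apply: spansetD |].
move=> c _ Ic [g [g_inj ->]]; apply: mem_spanset => //; exists g; split=> //.
by rewrite /nrdr; congr (nrdl _ _ _); apply/matrixP => i j; rewrite !mxE.
Qed.

Lemma shift_sequence_value (M : lmodType R) (Mstar : lmodType R^c) P2 P1 X :
  quadratic_presentations R S -> is_Ext 1 M Mstar ->
  Fittmax_shift_sequence S M P2 P1 X ->
  Omega_mul (Omega_mul (Omega_inv iota nrd S (Fittmaxl iota nrd P1))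
                       (Fittmaxl iota nrd P2)) (Fittmaxl iota nrd X) =
  Fittmaxr iota nrd Mstar.
Proof.
move=> quad Mstar_Ext seqX.
have square_regular P a (h : 'M[R]_a) : in_P S P -> presents h P ->
    forall x : 'rV_a, x *m h = 0 -> x = 0.
  move=> PP hP x; have [k [s [_ h_unit _]]] := norm_inverse PP hP.
  exact: (nrdl_unit_regular order_inj nrd_rn).
have [a2 [a1 [h2 [h1 [G0 [G1 [hP2 hP1 vX hG uM]]]]]]] :=
  shift_sequence_matrices quad square_regular Mstar_Ext seqX.
have [P2_P P1_P] : in_P S P2 /\ in_P S P1.
  by case: seqX => [? [? [? [? [? [? [_ [_ []]]]]]]]].
have [_ [_ [_ u2 _]]] := norm_inverse P2_P hP2.
have [_ [_ [_ u1 _]]] := norm_inverse P1_P hP1.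
have [F0 FD FM] := fittmax_submodule N IRM X.
rewrite (Omega_mul_square P1_P hP2 hP1 F0 FD FM).
(* Transposed and with signs changed, [h2 G0 = G1 h1] is a relation of the same kind with [Mstar]
   and [X] exchanged. *)
pose h2t : 'M[R^c]_a2 := h2^T; pose h1t : 'M[R^c]_a1 := h1^T.
pose G0t : 'M[R^c]_(a1, a2) := - G1^T; pose G1t : 'M[R^c]_(a1, a2) := - G0^T.
have hGt : h1t *m G0t = G1t *m h2t.
  by rewrite mulmxN mulNmx -(trmx_mul_rev G1 h1) -(trmx_mul_rev h2 G0) hG.
have vM : presents (col_mx G0t h2t) Mstar.
  by apply: presents_col_mxC; move: uM; rewrite tr_row_mx linearN.
have uX : presents ((row_mx h1t (- G1t))^T : 'M[R]_(_, _)) X.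
  by rewrite opprK tr_row_mx !trmxK; apply: presents_col_mxC.
have dom := fitting_ideal_dominated hG vX uM.
have domr := fitting_ideal_dominatedr hGt vM uX.
rewrite /nrdr !trmxK in domr.
have dir : directed (fitting_ideal N I X).
  by move=> J J'; apply: (fitting_ideal_directed Nl) hG vX.
have dirr : directed (fitting_ideal N' I Mstar).
  by move=> J J'; apply: (fitting_ideal_directed Nr) hGt vM.
apply/seteqP; split=> [_ [y Fy ->] | y Fy].
  have [z Fz yz] :=
    xget_maximal_scaled (mulrI u2) (mulrI u1) dir dirr dom domr Fy.
  by rewrite -mulrA yz mulKr.
have [x Fx xy] :=
  xget_maximal_scaled (mulrI u1) (mulrI u2) dirr dir domr dom Fy.
by exists x => //; rewrite -mulrA -xy mulKr.
Qed.

End FittingInvariants.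

Theorem proposition4p12
  (L : idomainType)
  (L_noetherian : noetherian_ring L)
  (L_local : local_ring L)
  (L_complete : complete_local_ring L)
  (A : falgType {fraction L})
  (A_separable : separable_algebra A)
  (R : algType L)
  (iota : {rmorphism R -> A})
  (R_order : is_order iota)
  (S : set L)
  (S_nonzero : ~ S 0)
  (S_ore : is_ore_set R S)
  (nrd : forall a, 'M[A]_a -> A)
  (nrd_reduced_norm : is_reduced_norm nrd)
  (R_quadratic : quadratic_presentations R S)
  (R_Ext_bound : finite_Ext_bound R)
  (M : lmodType R)
  (M_in_C : in_C S M)
  (Mstar : lmodType R^c)
  (Mstar_dual : is_Ext 1 M Mstar) :
  Fittmax_shift iota nrd S M = Fittmaxr iota nrd Mstar.
Proof.
have [S1 SM _ _] := S_ore.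
have [P2 [P1 [X seqX]]] := shift_sequence_exists S1 SM
  (@S_regular _ _ _ _ R_order _ S_nonzero) R_Ext_bound M_in_C.
have value := shift_sequence_value R_order S_nonzero S1 SM nrd_reduced_norm
  R_quadratic Mstar_dual.
(* The set from which the shift is chosen is a singleton: a sequence exists, and all of them give
   this value. *)
apply: xget_unique => [|_ [P2' [P1' [X' [seqX' ->]]]]]; last exact: value seqX'.
by exists P2, P1, X; split; last exact/esym/(value _ _ _ seqX).
Qed.
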